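(* Let $A$ be bounded, let $f$ be a valid function on $A\times\mathbb{R}$ that is strictly log-concave with respect to $y$, and consider the pairwise comparison sampling model described in the context (latent scores $u\in\mathbb{R}^n$ with $u_1=0$ and dynamic range $M_n$, comparison counts $n_{ij}\sim\mathrm{Bin}(T,p_{ij,n})$, minimum and maximum comparison rates $p_n,q_n$). Let $C_n^{(1)}=\int_{[0,\infty)}f(x;M_n)\,dx$, $g(x;y)=\frac{\partial}{\partial y}\log f(x;y)$, $g_2(x;y)=\frac{\partial}{\partial y}g(x;y)$, $$C_n^{(2)}=\sup_{x\in A,\,|y|\le M_n}|g(x;y)|,\qquad C_n^{(3)}=\inf_{x\in A,\,|y|\le M_n+1}|g_2(x;y)|,\qquad \omega_n=\frac{C_n^{(2)}}{C_n^{(3)}} .$$ Suppose that $$\Delta_n:=\omega_n\sqrt{\frac{q_n^2(\log n)^3}{n p_n^3}}\to0\quad\text{and}\quad \frac{\log n}{n p_n\,|\log C_n^{(1)}|}\to0\qquad\text{as } n\to\infty .$$ Then there exists an absolute constant $C>0$ such that for all sufficiently large $n$, with probability at least $1-n^{-2}$, the maximum likelihood estimator $\widehat{u}=\arg\max_{v\in\mathbb{R}^n,\,v_1=0}l(v)$ uniquely exists and satisfies $$\|\widehat{u}-u\|_\infty\le C\Delta_n .$$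
   Context: **Link function.** $A\subset\mathbb{R}$ is symmetric ($A=-A$) and is either continuous (integrals over $A$ are with respect to Lebesgue measure) or discrete (integrals $\int\cdot\,dx$ are read as sums over $A$). A function $f:A\times\mathbb{R}\to(0,\infty)$ is *valid* if: (1) $\int_A f(x;y)\,dx=1$ for every $y\in\mathbb{R}$; (2) $f(x;y)=f(-x;-y)$ for all $(x,y)\in A\times\mathbb{R}$; (3) for every $x\in A$ with $x<0$, $f(x;y)$ is decreasing in $y$ and $f(x;y)\to0$ as $y\to\infty$; (4) $\sup_{y\in\mathbb{R}}f(x;y)<\infty$ for every $x\in A$. $f$ is *strictly log-concave with respect to $y$* if for every $x\in A$, $\log f(x;y)$ is twice differentiable in $y$ and $\frac{\partial^2}{\partial y^2}\log f(x;y)<0$ for all $y\in\mathbb{R}$. $A$ and $f$ do not depend on $n$. **Sampling model.** For each $n$ there is a latent score vector $u=(u_1,\dots,u_n)\in\mathbb{R}^n$ (depending on $n$) with $u_1=0$, and $M_n=\max_{i,j}|u_i-u_j|$. $T\ge1$ is a fixed integer. For each pair $i\ne j$ there is a comparison rate $p_{ij,n}=p_{ji,n}\in(0,1]$, with $p_n=\min_{i\neq j}p_{ij,n}$ and $q_n=\max_{i\neq j}p_{ij,n}$. The numbers of comparisons $n_{ij}=n_{ji}$ are independent over pairs $i<j$, with $n_{ij}\sim\mathrm{Bin}(T,p_{ij,n})$. Given $\{n_{ij}\}$, the outcomes $X_{ij}^{(t)}$ ($i<j$, $1\le t\le n_{ij}$) are independent with density (mass function) $f(\cdot\,;u_i-u_j)$,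 and $X_{ji}^{(t)}=-X_{ij}^{(t)}$. **Log-likelihood.** $l(v)=\frac12\sum_{i\ne j}\sum_{t=1}^{n_{ij}}\log f(X_{ij}^{(t)};v_i-v_j)$ for $v\in\mathbb{R}^n$. Convention: $\omega_n=\infty$ if $C_n^{(2)}=\infty$ or $C_n^{(3)}=0$; the hypothesis on $\Delta_n$ thus forces $\omega_n<\infty$ for large $n$. *)

(* Defs.v *)
From mathcomp Require Export all_boot all_order all_algebra.
From mathcomp Require Export all_classical all_reals all_analysis.

Set Implicit Arguments.
Unset Strict Implicit.
Unset Printing Implicit Defensive.

Import Order.TTheory GRing.Theory Num.Theory.
Import numFieldNormedType.Exports.

Local Open Scope classical_set_scope.
Local Open Scope ring_scope.

Variant outcome_kind := Continuous | Discrete.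

Section LinkFunction.
Context {R : realType}.
Implicit Types (k : outcome_kind) (A D : set R) (f : R -> R -> R).

(* [integral_over k D h] is the integral of h over D with respect to Lebesgue
   measure, or the sum of h over D; it is only used for h >= 0 on D. *)
Definition integral_over k D (h : R -> R) : \bar R :=
  match k with
  | Continuous => (\int[lebesgue_measure]_(x in D) (h x)%:E)%E
  | Discrete => \esum_(x in D) (h x)%:E
  end.

Definition outcome_domain k A : Prop :=
  (forall x, A x -> A (- x)) /\
  match k with
  | Continuous => measurable A
  | Discrete => countable A
  end.

(* A function on A x R is represented by f : R -> R -> R whose values f x y at
   x outside A are irrelevant. Measurability in x is what makes the integrals
   over A meaningful; it is automatic when A is countable. *)
Record valid k A f : Prop := Valid {
  valid_dom : outcome_domain k A ;
  valid_pos : forall x y, A x -> 0 < f x y ;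
  valid_meas : forall y, measurable_fun A (f ^~ y) ;
  valid_mass : forall y, integral_over k A (f ^~ y) = 1%E ;
  valid_sym : forall x y, A x -> f x y = f (- x) (- y) ;
  valid_decr : forall x, A x -> x < 0 ->
    (forall y z, y <= z -> f x z <= f x y) /\ f x y @[y --> +oo] --> (0 : R) ;
  valid_bounded : forall x, A x -> (ereal_sup [set (f x y)%:E | y in setT] < +oo)%E
}.

Definition score f (x y : R) : R := derive1 (fun z => ln (f x z)) y.

Definition score2 f (x y : R) : R := derive1 (score f x) y.

Definition strictly_log_concave A f : Prop :=
  forall x, A x -> forall y,
    [/\ derivable (fun z => ln (f x z)) y 1,
        derivable (score f x) y 1 &
        score2 f x y < 0].

Definition C1 k A f (M : R) : \bar R :=
  integral_over k (A `&` [set x | 0 <= x]) (f ^~ M).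

Definition C2 A f (M : R) : \bar R :=
  ereal_sup [set (`|score f x y|)%:E | x in A & y in [set y | `|y| <= M]].

Definition C3 A f (M : R) : \bar R :=
  ereal_inf [set (`|score2 f x y|)%:E | x in A & y in [set y | `|y| <= M + 1]].

Definition omega A f (M : R) : \bar R :=
  if (C2 A f M == +oo%E) || (C3 A f M == 0%E) then +oo%E
  else (C2 A f M / C3 A f M)%E.

End LinkFunction.

Section Rates.
Context {R : realType} {n : nat}.

Definition dynamic_range (u : 'rV[R]_n) : R :=
  \big[Num.max/0]_(ij : 'I_n * 'I_n) `|u 0 ij.1 - u 0 ij.2|.

(* The units 1 and 0 below are inert for n >= 2 because rates lie in (0, 1]. *)
Definition min_rate (p : 'I_n -> 'I_n -> R) : R :=
  \big[Num.min/1]_(ij : 'I_n * 'I_n | ij.1 != ij.2) p ij.1 ij.2.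

Definition max_rate (p : 'I_n -> 'I_n -> R) : R :=
  \big[Num.max/0]_(ij : 'I_n * 'I_n | ij.1 != ij.2) p ij.1 ij.2.

Definition Delta (A : set R) (f : R -> R -> R) (u : 'rV[R]_n)
    (p : 'I_n -> 'I_n -> R) : \bar R :=
  (omega A f (dynamic_range u) *
   (Num.sqrt (max_rate p ^+ 2 * ln n%:R ^+ 3 / (n%:R * min_rate p ^+ 3)))%:E)%E.

End Rates.

Section Sampling.
Context {R : realType} {d : measure_display} {Omega : measurableType d}.
Variable P : probability Omega R.

Definition mutually_independent (I : finType) (d' : measure_display)
    (V : measurableType d') (J : {set I}) (Y : I -> {RV P >-> V}) : Prop :=
  forall (K : {set I}) (B : I -> set V),
    K \subset J -> (forall i, measurable (B i)) ->
    P (\bigcap_(i in [set` K]) (Y i @^-1` B i)) =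
    (\prod_(i in K) P (Y i @^-1` B i))%E.

Context {n : nat}.
Variables (k : outcome_kind) (A : set R) (f : R -> R -> R) (T : nat).
Variables (u : 'rV[R]_n) (p : 'I_n -> 'I_n -> R).
Variable N : 'I_n -> 'I_n -> {RV P >-> nat}.
Variable X : 'I_n -> 'I_n -> nat -> {RV P >-> R}.

Definition rates : Prop :=
  forall i j, i != j -> p i j = p j i /\ 0 < p i j <= 1.

Definition counts : Prop :=
  [/\ forall i j w, N i j w = N j i w,
      mutually_independent [set ij : 'I_n * 'I_n | (ij.1 < ij.2)%N]
        (fun ij => N ij.1 ij.2) &
      forall i j : 'I_n, (i < j)%N -> forall B : set nat,
        distribution P (N i j) B = binomial_prob T (p i j) B].

Definition counts_are (c : 'I_n -> 'I_n -> nat) : set Omega :=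
  [set w | forall i j : 'I_n, (i < j)%N -> N i j w = c i j].

(* X i j t is the (t+1)-st outcome of the pair (i, j). It is observed only when
   t < N i j, and nothing is assumed about the unobserved ones. The second
   clause says that conditionally on each event {N = c} the observed outcomes
   are independent with law f(.; u_i - u_j); it is written without dividing by
   P {N = c}, which may vanish. *)
Definition outcomes : Prop :=
  (forall (i j : 'I_n) t w, (i < j)%N -> (t < N i j w)%N -> X j i t w = - X i j t w) /\
  (forall (c : 'I_n -> 'I_n -> nat) (B : 'I_n -> 'I_n -> nat -> set R),
     (forall i j t, measurable (B i j t)) ->
     P (counts_are c `&`
        [set w | forall (i j : 'I_n) t, (i < j)%N -> (t < c i j)%N -> B i j t (X i j t w)]) =
     (P (counts_are c) *
      \prod_(ij : 'I_n * 'I_n | (ij.1 < ij.2)%N) \prod_(t < c ij.1 ij.2)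
        integral_over k (A `&` B ij.1 ij.2 t) (f ^~ (u 0 ij.1 - u 0 ij.2)%R))%E).

Definition normalized (v : 'rV[R]_n) : Prop :=
  forall i : 'I_n, i = 0 :> nat -> v 0 i = 0.

Record sampling_model : Prop := SamplingModel {
  model_normalized : normalized u ;
  model_rates : rates ;
  model_counts : counts ;
  model_outcomes : outcomes
}.

Definition log_likelihood (w : Omega) (v : 'rV[R]_n) : R :=
  2^-1 * \sum_(ij : 'I_n * 'I_n | ij.1 != ij.2) \sum_(t < N ij.1 ij.2 w)
    ln (f (X ij.1 ij.2 t w) (v 0 ij.1 - v 0 ij.2)).

Definition is_mle (w : Omega) (v : 'rV[R]_n) : Prop :=
  normalized v /\
  forall v', normalized v' -> log_likelihood w v' <= log_likelihood w v.

End Sampling.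

(* Main.v *)
(** Let [a := uhat - u], where [uhat] maximizes the likelihood among the normalized [v] such that
    [v - u] has bounded spread. Lowering [uhat] on a superlevel set [S] of [a] does not increase
    the spread, so the scores at [uhat] of the comparisons across the cut [(S, ~: S)] have a
    nonnegative sum. Compared with their values at [u], every comparison of [S] with a point where
    [a] is lower by [delta] has lost [C3 * delta]; since the scores at [u] add up to at most
    [tau * C2] per comparison of the cut, at most half of these comparisons lead to points lower by
    [delta := 2 * (C2 / C3) * tau]. As the comparison graph expands, the superlevel set at level
    [x - delta] is larger than the one at level [x] by a factor [1 + p_n / (64 * q_n)], hence
    [O((q_n / p_n) * ln n)] steps lead from the maximum of [a] to more than half of the points. The
    same holds from the minimum, which bounds the spread of [a]; so [uhat] is an interior point and
    a global maximizer by concavity.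

    The scores are centred because [1 = \int f(x; y + t) dx <= \int f(x; y) exp(t * g(x; y)) dx]
    for all [t], by log-concavity. Rounding them to finitely many cells turns counts and outcomes
    into a finite product space, where Chernoff bounds and a union bound over all [S] apply. The
    sum over the cut is controlled relative to the random number of comparisons of the cut; a bound
    in terms of [n * q_n] would lose a factor [sqrt (q_n / p_n)]. *)

Require Import Defs.
From mathcomp Require Import zify ring lra measurable_realfun.

Set Implicit Arguments.
Unset Strict Implicit.
Unset Printing Implicit Defensive.

Import Order.TTheory GRing.Theory Num.Theory.
Import numFieldNormedType.Exports.

Local Open Scope classical_set_scope.
Local Open Scope ring_scope.

(** * Chernoff bound on a finite product space *)

Section RealBounds.
Context {R : realType}.
Implicit Types x y : R.

Lemma expR_le_quadratic x : `|x| <= 3^-1 -> expR x <= 1 + x + x ^+ 2.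
Proof.
rewrite ler_norml => /andP[x0 x1].
have h1 : 1 - x / 2 <= expR (- (x / 2)) by apply: expR_ge1Dx.
have h2 : 0 < 1 - x / 2 by lra.
have h3 : expR (x / 2) <= (1 - x / 2)^-1.
  by rewrite -[leLHS]invrK lef_pV2 ?posrE ?invr_gt0 ?expR_gt0// -expRN.
have -> : expR x = expR (x / 2) ^+ 2 by rewrite expr2 -expRD; congr expR; lra.
apply: (@le_trans _ _ ((1 - x / 2)^-1 ^+ 2)).
  by rewrite lerXn2r ?nnegrE ?expR_ge0 ?invr_ge0// ltW.
rewrite exprVn -[leLHS]mul1r ler_pdivrMr ?exprn_gt0//.
(* Four times the excess of [(1 - x / 2) ^+ 2 * (1 + x + x ^+ 2)] over 1, nonnegative as
   [x <= 3^-1]. *)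
have : 0 <= x ^+ 2 * (1 - 3 * x + x ^+ 2).
  by rewrite mulr_ge0 ?sqr_ge0// addr_ge0 ?sqr_ge0//; lra.
nra.
Qed.

Lemma expRN_le x : 0 <= x <= 1 -> expR (- x) <= 1 - x / 2.
Proof.
move=> /andP[x0 x1]; rewrite expRN.
have h : 1 + x <= expR x by apply: expR_ge1Dx.
apply: (@le_trans _ _ (1 + x)^-1).
  by rewrite lef_pV2 ?posrE ?expR_gt0//; lra.
by rewrite -[leLHS]mul1r ler_pdivrMr; [nra|lra].
Qed.

Lemma expR1_le4 : expR 1 <= 4 :> R.
Proof.
have h : 1 - 2^-1 <= expR (- 2^-1) :> R by apply: expR_ge1Dx.
have -> : 1 = 2^-1 + 2^-1 :> R by lra.
rewrite expRD.
have h2 : expR (2^-1) <= 2 :> R.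
  rewrite -[leLHS]invrK -expRN -[leRHS]invrK lef_pV2 ?posrE ?expR_gt0//; lra.
by have := expR_gt0 (2^-1 : R); nra.
Qed.

Lemma expR1_ge2 : 2 <= expR 1 :> R.
Proof. by have := expR_ge1Dx (1 : R); lra. Qed.

End RealBounds.

Section Chernoff.
Context {R : realType} (I K : finType) (D : pred I) (T : nat).

(* What is kept of a pair: its number of comparisons and the cell of each outcome. *)
Definition record : finType := {c : 'I_T.+1 & {ffun 'I_c -> K}}.

Definition no_record : record :=
  Tagged (fun c : 'I_T.+1 => {ffun 'I_c -> K}) (ffun0 (card_ord 0) : {ffun 'I_(@ord0 T) -> K}).

Variables (p : I -> R) (mu : I -> K -> R).
Hypothesis p01 : forall i, D i -> 0 <= p i <= 1.
Hypothesis mu_ge0 : forall i k, D i -> 0 <= mu i k.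
Hypothesis mu_sum1 : forall i, D i -> \sum_k mu i k = 1.

Definition record_weight i (o : record) : R :=
  binomial_pmf T (p i) (tag o) * \prod_t mu i (tagged o t).

Definition weight (x : {ffun I -> record}) : R := \prod_(i | D i) record_weight i (x i).

(* Outside [D] the entries are frozen to [no_record]. *)
Definition configs : {pred {ffun I -> record}} := pffun_on no_record D predT.

Lemma record_weight_ge0 i o : D i -> 0 <= record_weight i o.
Proof.
move=> Di; have /andP[p0 p1] := p01 Di.
rewrite mulr_ge0 ?prodr_ge0//; last by move=> t _; exact: mu_ge0.
by rewrite /binomial_pmf mulrn_wge0// mulr_ge0 ?exprn_ge0// subr_ge0.
Qed.

Lemma weight_ge0 x : 0 <= weight x.
Proof. by apply: prodr_ge0 => i Di; exact: record_weight_ge0. Qed.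

(** For a fixed count [c] the sum over outcome tuples factors into a [c]-th power, and the binomial
    theorem sums over [c]: each of the [T] possible comparisons takes place with probability
    [p i]. *)
Lemma record_mgf i (h : K -> R) :
  \sum_o record_weight i o * \prod_t h (tagged o t)
  = (1 - p i + p i * \sum_k mu i k * h k) ^+ T.
Proof.
rewrite /record_weight.
under eq_bigr do rewrite -mulrA -big_split/=.
rewrite -(@sig_big_dep _ _ _ _ (fun c : 'I_T.+1 => {ffun 'I_c -> K}) xpredT (fun _ => xpredT)
  (fun c v => binomial_pmf T (p i) c * \prod_t (mu i (v t) * h (v t))))/=.
rewrite exprDn; apply: eq_bigr => c _.
rewrite -big_distrr/= -(bigA_distr_bigA (fun (t : 'I_c) k => mu i k * h k))/=.
rewrite prodr_const card_ord /binomial_pmf exprMn.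
by rewrite mulrnAl; congr (_ *+ _); rewrite /unstable.onem; ring.
Qed.

Lemma sum_weight_prod (h : I -> K -> R) :
  \sum_(x in configs) weight x * \prod_(i | D i) \prod_t h i (tagged (x i) t)
  = \prod_(i | D i) (1 - p i + p i * \sum_k mu i k * h i k) ^+ T.
Proof.
rewrite (eq_bigr (fun x : {ffun I -> record} =>
  \prod_(i | D i) (record_weight i (x i) * \prod_t h i (tagged (x i) t)))); last first.
  by move=> x _; rewrite big_split.
rewrite -(big_distr_big no_record D predT (fun i o => record_weight i o * \prod_t h i (tagged o t)))/=.
by apply: eq_bigr => i _; exact: record_mgf.
Qed.

Lemma sum_weight : \sum_(x in configs) weight x = 1.
Proof.
have := sum_weight_prod (fun _ _ => 1); rewrite [RHS]big1 => [<-|i Di].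
  by apply: eq_bigr => x _; rewrite big1 ?mulr1// => i _; rewrite big1.
under eq_bigr do rewrite mulr1.
by rewrite mu_sum1// mulr1 subrK expr1n.
Qed.

(** Markov's inequality for the exponential of the sum; the product from [sum_weight_prod] is then
    bounded factor by factor with [1 + z <= expR z], which makes the exponent linear in the
    rates. *)
Lemma chernoff (eta : I -> K -> R) (b : R) :
  \sum_(x in configs | b <= \sum_(i | D i) \sum_t eta i (tagged (x i) t)) weight x
  <= expR (- b + T%:R * \sum_(i | D i) p i * (\sum_k mu i k * expR (eta i k) - 1)).
Proof.
apply: (@le_trans _ _ (\sum_(x in configs) expR (- b) * (weight x *
    \prod_(i | D i) \prod_t expR (eta i (tagged (x i) t))))).
  rewrite big_mkcondr/=; apply: ler_sum => x _; case: ifPn => [bx|_].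
    rewrite mulrCA -[leLHS]mulr1 ler_wpM2l ?weight_ge0//.
    under eq_bigr do rewrite -expR_sum.
    by rewrite -expR_sum -expRD -[leLHS]expR0 ler_expR addrC subr_ge0.
  rewrite !mulr_ge0 ?expR_ge0 ?weight_ge0//.
  by apply: prodr_ge0 => i _; apply: prodr_ge0 => t _; exact: expR_ge0.
rewrite -big_distrr/= (sum_weight_prod (fun i k => expR (eta i k))) expRD.
rewrite ler_wpM2l ?expR_ge0// big_distrr/= expR_sum.
apply: ler_prod => i Di.
have /andP[p0 p1] := p01 Di.
have m0 : 0 <= \sum_k mu i k * expR (eta i k).
  by apply: sumr_ge0 => k _; rewrite mulr_ge0 ?expR_ge0 ?mu_ge0.
have h0 : 0 <= 1 - p i + p i * \sum_k mu i k * expR (eta i k).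
  by rewrite addr_ge0 ?mulr_ge0// subr_ge0.
rewrite exprn_ge0//= expRM_natl lerXn2r ?nnegrE ?expR_ge0//.
by apply: le_trans (expR_ge1Dx _); rewrite mulrBr; lra.
Qed.

End Chernoff.

(** * Link functions *)

Section Calculus.
Context {R : realType}.
Implicit Types (h : R -> R) (x y z : R).

Lemma derivable_MVT h y z : (forall t, derivable h t 1) -> y < z ->
  exists2 t, y < t < z & h z - h y = derive1 h t * (z - y).
Proof.
move=> dh yz.
have [t] := @MVT R h (derive1 h) y z yz
  (fun t _ => @is_derive_eq _ _ _ _ _ _ _ _ (derivableP (dh t)) (esym (derive1E h t)))
  (derivable_within_continuous (fun t _ => dh t)).
by rewrite in_itv => ? ->; exists t.
Qed.

Lemma derivable_continuous h : (forall t, derivable h t 1) -> continuous h.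
Proof. by move=> dh t; apply/differentiable_continuous/derivable1_diffP. Qed.

Lemma tangent_lt h y z : (forall t, derivable h t 1) ->
  {homo derive1 h : s t / s < t >-> t < s} -> y != z ->
  h z < h y + derive1 h y * (z - y).
Proof.
move=> dh dec; rewrite neq_lt => /orP[yz|zy].
- have [t /andP[yt _]] := derivable_MVT dh yz; have := dec _ _ yt; nra.
- have [t /andP[_ ty]] := derivable_MVT dh zy; have := dec _ _ ty; nra.
Qed.

End Calculus.

Section Link.
Context {R : realType}.
Variables (k : outcome_kind) (A : set R) (f : R -> R -> R).
Hypothesis V : valid k A f.
Hypothesis slc : strictly_log_concave A f.
Implicit Types (x y z M c : R).

Lemma derivable_lnf x : A x -> forall y, derivable (fun z => ln (f x z)) y 1.
Proof. by move=> Ax y; have [] := slc Ax y. Qed.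

Lemma derivable_score x : A x -> forall y, derivable (score f x) y 1.
Proof. by move=> Ax y; have [] := slc Ax y. Qed.

Lemma score_decr x : A x -> {homo score f x : y z / y < z >-> z < y}.
Proof.
move=> Ax y z yz; have [t _] := derivable_MVT (derivable_score Ax) yz.
by have [_ _] := slc Ax t; rewrite /score2; nra.
Qed.

Lemma score_nincr x y z : A x -> y <= z -> score f x z <= score f x y.
Proof. by move=> Ax; rewrite le_eqVlt => /predU1P[->//|/(score_decr Ax)/ltW]. Qed.

Lemma lnf_tangent_lt x y z : A x -> y != z ->
  ln (f x z) < ln (f x y) + score f x y * (z - y).
Proof. by move=> Ax; apply: tangent_lt; [exact: derivable_lnf|exact: score_decr]. Qed.

Lemma lnf_tangent x y z : A x -> ln (f x z) <= ln (f x y) + score f x y * (z - y).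
Proof.
move=> Ax; have [->|yz] := eqVneq y z; first by rewrite subrr mulr0 addr0.
exact/ltW/lnf_tangent_lt.
Qed.

Lemma f_tangent x y z : A x -> f x z <= f x y * expR (score f x y * (z - y)).
Proof.
move=> Ax; have f0 := valid_pos V.
rewrite -[leLHS]lnK ?posrE ?f0//.
have -> : f x y = expR (ln (f x y)) by rewrite lnK ?posrE ?f0.
by rewrite -expRD ler_expR lnf_tangent.
Qed.

Lemma lnf_continuous x : A x -> continuous (fun z => ln (f x z)).
Proof. by move=> Ax; apply: derivable_continuous; exact: derivable_lnf. Qed.

Lemma score_sym x y : A x -> score f x y = - score f (- x) (- y).
Proof.
move=> Ax; have ANx : A (- x) by have [sA _] := valid_dom V; exact: sA.
rewrite /score.
have -> : (fun z => ln (f x z)) = (fun z => ln (f (- x) z)) \o -%R.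
  by apply/funext => z /=; rewrite (valid_sym V z Ax).
rewrite derive1_comp; [|exact: derivable_opp|exact: derivable_lnf].
by rewrite (derive1E -%R) derive_val mulrN1.
Qed.

(** The bound on [score2] reaches only to [M + 1], so curvature is gained over a length of at most
    1; further on, monotonicity of the score preserves the gain. Hence the cap [Num.min z 1]. *)
Lemma score_decay M c3 x y z : A x -> 0 <= M ->
  (forall t, `|t| <= M + 1 -> c3 <= `|score2 f x t|) ->
  `|y| <= M -> 0 <= z ->
  score f x (y + z) <= score f x y - c3 * Num.min z 1.
Proof.
move=> Ax M0 hc3 yM z0.
wlog z1 : z z0 / z <= 1.
  move=> H; have [z1|] := boolP (z <= 1); first exact: H.
  rewrite -ltNge => z1.
  apply: le_trans (score_nincr Ax (_ : y + 1 <= y + z)) _; first by rewrite lerD2l ltW.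
  by have := H 1 ler01 (lexx 1); rewrite minxx (min_r (ltW z1)).
rewrite min_l//; move: z0; rewrite le_eqVlt => /predU1P[<-|z0].
  by rewrite addr0 mulr0 subr0.
have yz : y < y + z by rewrite ltrDl.
have [t /andP[yt ty]] := derivable_MVT (derivable_score Ax) yz.
have : c3 <= `|score2 f x t|.
  by apply: hc3; move: yM; rewrite !ler_norml; lra.
have [_ _ neg] := slc Ax t; rewrite ltr0_norm// -/(score2 f x t) => h.
have := ler_wpM2r (ltW z0) h; lra.
Qed.

(** Otherwise, by symmetry, [A] is empty or [{0}]. The total mass is then 0 instead of 1, except for
    a discrete [{0}], where [f 0] is constantly 1 and its logarithm is not strictly concave. *)
Lemma exists_neg : exists2 x, A x & x < 0.
Proof.
apply: contrapT => no.
have A0 x : A x -> x = 0.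
  move=> Ax; have [x0|x0|//] := ltgtP x 0; exfalso; apply: no; first by exists x.
  by exists (- x); [have [sA _] := valid_dom V; exact: sA|rewrite oppr_lt0].
have [k1|k1] : k = Continuous \/ k = Discrete by case: k; [left|right].
- have := valid_mass V 0; rewrite k1 /= null_set_integral//.
  + by move/esym/eqP; rewrite onee_eq0.
  + by have [_] := valid_dom V; rewrite k1.
  + by apply/measurable_EFinP; exact: valid_meas V 0.
  + apply/eqP; rewrite -measure_le0 -(lebesgue_measure_set1 0).
    apply: le_measure; rewrite ?inE.
    * by have [_] := valid_dom V; rewrite k1.
    * exact: measurable_set1.
    * by move=> x /A0.
- have [A00|nA0] := pselect (A 0); last first.
    have AE : A = set0 by rewrite -subset0 => x Ax; apply: nA0; rewrite -(A0 _ Ax).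
    by have := valid_mass V 0; rewrite k1 AE /= esum_set0 => /esym/eqP; rewrite onee_eq0.
  have AE : A = [set 0] by apply/seteqP; split => [x /A0|x ->].
  have f1 y : f 0 y = 1.
    have := valid_mass V y; rewrite k1 AE /= esum_set1 ?lee_fin ?ltW ?(valid_pos V)//.
    by move=> [].
  have [_ _] := slc A00 0; rewrite /score2.
  have -> : score f 0 = cst 0.
    apply/funext => y; rewrite /score.
    have -> : (fun z => ln (f 0 z)) = cst 0 by apply/funext => z; rewrite f1 ln1.
    by rewrite derive1_cst.
  by rewrite derive1_cst ltxx.
Qed.

(* For [x < 0] the score is nonpositive at [- M - 1], then drops by [c3 * (2 * M + 1)] up to [M]. *)
Lemma score_ge_curvature M c c3 : 0 <= M ->
  (forall x t, A x -> `|t| <= M -> `|score f x t| <= c) ->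
  (forall x t, A x -> `|t| <= M + 1 -> c3 <= `|score2 f x t|) -> 0 <= c3 -> c3 <= c.
Proof.
move=> M0 hc hc3 c30; have [x Ax x0] := exists_neg.
have score_le0 y : score f x y <= 0.
  rewrite leNgt; apply/negP => s0.
  have := lnf_tangent_lt Ax (_ : y != y - 1); rewrite -subr_eq0 opprB addrCA subrr addr0 oner_eq0.
  move=> /(_ isT); have [dec _] := valid_decr V Ax x0.
  have : ln (f x y) <= ln (f x (y - 1)).
    by rewrite ler_ln ?posrE ?(valid_pos V)//; apply: dec; rewrite gerBl.
  by nra.
have MM : - M - 1 < M by lra.
have [t /andP[t1 t2] eq] := derivable_MVT (derivable_score Ax) MM.
have tM : `|t| <= M + 1 by rewrite ler_norml; lra.
have := hc3 _ _ Ax tM; have [_ _ neg] := slc Ax t.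
have := hc _ M Ax; rewrite ger0_norm// => /(_ (lexx _)).
rewrite (ler0_norm (score_le0 M)) (ltr0_norm neg).
have := score_le0 (- M - 1); move: eq; rewrite -/(score2 f x t).
nra.
Qed.

End Link.

(** * Integration over the outcome domain *)

Section IntegralOver.
Context {R : realType} (k : outcome_kind).
Implicit Types (A D : set R) (h : R -> R).

Lemma outcome_domain_measurable A : outcome_domain k A -> measurable A.
Proof.
move=> [_]; case: k => // cA.
by apply: countable_measurable => // t; exact: measurable_set1.
Qed.

Lemma integral_over_ge0 D h : (forall x, D x -> 0 <= h x) -> (0 <= integral_over k D h)%E.
Proof.
move=> h0; case: k => /=.
  by apply: integral_ge0 => x /h0; rewrite lee_fin.
by apply: esum_ge0 => x /h0; rewrite lee_fin.
Qed.

Lemma integral_over_setID A B h : measurable A -> measurable B -> measurable_fun A h ->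
  (forall x, A x -> 0 <= h x) ->
  integral_over k A h = (integral_over k (A `&` B) h + integral_over k (A `&` ~` B) h)%E.
Proof.
move=> mA mB mh h0; case: k => /=; last by apply: esumID => x /h0; rewrite lee_fin.
rewrite -ge0_integral_setU.
- by rewrite -setIUr setUv setIT.
- exact: measurableI.
- by apply: measurableI => //; exact: measurableC.
- by rewrite -setIUr setUv setIT; exact/measurable_EFinP.
- by move=> x; rewrite -setIUr setUv setIT => /h0; rewrite lee_fin.
- by apply/disj_setPS => x [[_ Bx] [_ /(_ Bx)]].
Qed.

Lemma integral_over_set0 h : integral_over k set0 h = 0%E.
Proof. by case: k => /=; [exact: integral_set0|exact: esum_set0]. Qed.

Lemma integral_over_partition A h (K : finType) (cell : R -> K) :
  measurable A -> measurable_fun A h -> (forall x, A x -> 0 <= h x) ->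
  (forall i, measurable (A `&` cell @^-1` [set i])) ->
  integral_over k A h = (\sum_i integral_over k (A `&` cell @^-1` [set i]) h)%E.
Proof.
move=> mA mh h0 mcell.
suff H (s : seq K) : uniq s -> integral_over k (A `&` [set x | cell x \in s]) h =
    (\sum_(i <- s) integral_over k (A `&` cell @^-1` [set i]) h)%E.
  rewrite -[RHS]/(\sum_(i <- index_enum K) _)%E -H ?index_enum_uniq//; congr integral_over.
  by apply/seteqP; split => [x Ax|x []//]; split => //=; rewrite mem_index_enum.
have mI (r : seq K) : measurable (A `&` [set x | cell x \in r]).
  rewrite (_ : A `&` _ = \bigcup_(i in [set` r]) (A `&` cell @^-1` [set i])).
    by apply: fin_bigcup_measurable => [|i _]; [exact: finite_seq|exact: mcell].
  apply/seteqP; split => [x [Ax xs]|x [i /= si [Ax /= cx]]]; first by exists (cell x).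
  by split => //=; rewrite cx.
elim: s => [|i s IH] /= => [_|/andP[nis us]].
  by rewrite big_nil (_ : _ `&` _ = set0) ?integral_over_set0//; apply/seteqP; split => x []//.
rewrite big_cons -IH// (@integral_over_setID _ (A `&` cell @^-1` [set i]))//.
- congr (_ + _)%E; congr integral_over; apply/seteqP; split => x /=.
  + by move=> [[Ax _] [_ cx]].
  + by move=> [Ax ->]; rewrite inE eqxx.
  + move=> [[Ax]]; rewrite inE => /orP[/eqP cx|//] nx; exfalso; exact: nx.
  + move=> [Ax xs]; split; first by split => //; rewrite inE xs orbT.
    by move=> [_ cx]; move: nis; rewrite -cx xs.
- exact: measurable_funS mh.
- by move=> x [/h0].
Qed.

Lemma le_integral_over_scale D h1 h2 c : measurable D ->
  measurable_fun D h1 -> measurable_fun D h2 ->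
  (forall x, D x -> 0 <= h1 x) -> (forall x, D x -> 0 <= h2 x) -> 0 <= c ->
  (forall x, D x -> h1 x <= c * h2 x) ->
  (integral_over k D h1 <= c%:E * integral_over k D h2)%E.
Proof.
move=> mD m1 m2 h10 h20 c0 h12; case: k => /=.
  rewrite -ge0_integralZl ?lee_fin//.
  - apply: ge0_le_integral; [exact: mD| | | |].
    + by move=> x /h10; rewrite lee_fin.
    + exact/measurable_EFinP.
    + by apply/measurable_EFinP; apply: measurable_funM => //; exact: measurable_cst.
    + by move=> x /h12; rewrite lee_fin.
  - exact/measurable_EFinP.
apply: ge_ereal_sup => _ [F [fF FD] <-].
(* Cancelling [c%:E] below needs [0 < c]. *)
have [c0'|c0'] := eqVneq c 0.
  rewrite c0' mul0e fsbig_finite//= sumEFin lee_fin big_seq sumr_le0// => x.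
  by rewrite in_fset_set// inE => /FD/h12; rewrite c0' mul0r.
apply: (@le_trans _ _ (c%:E * \sum_(x \in F) (h2 x)%:E)%E).
  rewrite !fsbig_finite//= !sumEFin -EFinM lee_fin mulr_sumr.
  rewrite big_seq [leRHS]big_seq; apply: ler_sum => x.
  by rewrite in_fset_set// inE => /FD; exact: h12.
rewrite lee_pmul2l ?lte_fin ?lt_neqAle 1?eq_sym ?c0'//.
by apply: ereal_sup_ubound; exists F.
Qed.

End IntegralOver.

(** * Exponential moments of rounded scores *)

Section FiniteMgf.
Context {R : realType} (K : finType).
Variables (w a : K -> R) (c eps lam : R).
Hypothesis w_ge0 : forall i, 0 <= w i.
Hypothesis w_sum1 : \sum_i w i = 1.
Hypothesis c_gt0 : 0 < c.
Hypothesis lam_gt0 : 0 < lam.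
Hypothesis lam_c : lam * c <= 4^-1.
Hypothesis epsE : eps = lam * c ^+ 2 / 2.
Hypothesis a_le : forall i, `|a i| <= c + eps.

(** The sum in the hypothesis equals 1 at [t = 0], with derivative [eps] minus the mean; a mean
    above [eps] would push it below 1 for small [t]. *)
Lemma mean_le : (forall t, 0 < t -> 1 <= \sum_i w i * expR (- t * (a i - eps))) ->
  \sum_i w i * a i <= eps.
Proof.
move=> H; have eps0 : 0 <= eps by rewrite epsE !mulr_ge0 ?sqr_ge0// ltW.
pose B := c + 2 * eps.
have B0 : 0 < B by rewrite ltr_wpDr ?mulr_ge0.
rewrite leNgt; apply/negP => gt.
pose m := \sum_i w i * a i - eps.
have m0 : 0 < m by rewrite subr_gt0.
(* The first bound admits the quadratic estimate of the exponential, the second keeps the quadratic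
   term within half of the linear gain [t * m]. *)
pose t := Num.min ((3 * B)^-1) (m / (2 * B ^+ 2)).
have t0 : 0 < t by rewrite lt_min invr_gt0 mulr_gt0//= divr_gt0// mulr_gt0// exprn_gt0.
have t1 : t * B <= 3^-1.
  have : t <= (3 * B)^-1 by rewrite ge_min lexx.
  by move=> /(ler_wpM2r (ltW B0)) /le_trans; apply; rewrite invfM mulfVK// gt_eqF.
have t2 : t * B ^+ 2 <= m / 2.
  have : t <= m / (2 * B ^+ 2) by rewrite ge_min lexx orbT.
  move=> /(ler_wpM2r (sqr_ge0 B)) /le_trans; apply.
  by rewrite le_eqVlt; apply/orP; left; apply/eqP; field; rewrite gt_eqF.
have b_le i : `|a i - eps| <= B.
  by have := a_le i; rewrite /B !ler_norml; lra.
have : 1 <= \sum_i w i * (1 - t * (a i - eps) + t ^+ 2 * B ^+ 2).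
  apply: le_trans (H t t0) _; apply: ler_sum => i _; rewrite ler_wpM2l//.
  apply: le_trans (expR_le_quadratic _) _.
    rewrite normrM normrN (gtr0_norm t0); apply: le_trans t1.
    by rewrite ler_wpM2l// ltW.
  rewrite mulNr lerD2l sqrrN exprMn ler_wpM2l ?sqr_ge0//.
  by rewrite -real_normK ?num_real// lerXn2r ?nnegrE ?(ltW B0).
have -> : \sum_i w i * (1 - t * (a i - eps) + t ^+ 2 * B ^+ 2) =
  1 - t * m + t ^+ 2 * B ^+ 2.
  rewrite -[in RHS]w_sum1 /m.
  have -> : \sum_i w i * (1 - t * (a i - eps) + t ^+ 2 * B ^+ 2) =
    \sum_i ((1 + t * eps + t ^+ 2 * B ^+ 2) * w i - t * (w i * a i)).
    by apply: eq_bigr => i _; ring.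
  rewrite sumrB -!mulr_sumr w_sum1; ring.
have : t * (t * B ^+ 2) <= t * (m / 2) by rewrite ler_pM2l.
have := mulr_gt0 t0 m0.
lra.
Qed.

(** Put [s = lam * c]. In the quadratic estimate the mean contributes at most [s ^+ 2 / 2] by
    [mean_le], and the square at most [(s + s ^+ 2 / 2) ^+ 2]; together they stay below [2 * s ^+ 2]
    because [s <= 4^-1]. *)
Lemma mgf_le : (forall t, 0 < t -> 1 <= \sum_i w i * expR (- t * (a i - eps))) ->
  \sum_i w i * expR (lam * a i) <= expR (2 * (lam * c) ^+ 2).
Proof.
move=> /mean_le mean; apply: le_trans (expR_ge1Dx _).
have lc0 : 0 < lam * c by rewrite mulr_gt0.
have le_eps : lam * (c + eps) <= 9 / 32.
  have -> : lam * (c + eps) = lam * c + (lam * c) ^+ 2 / 2 by rewrite epsE; ring.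
  by move: lam_c lc0; set s := lam * c => s1 s0; nra.
have eps0 : 0 <= eps by rewrite epsE !mulr_ge0 ?sqr_ge0// ltW.
apply: (@le_trans _ _ (\sum_i w i * (1 + lam * a i + (lam * (c + eps)) ^+ 2))).
  apply: ler_sum => i _; rewrite ler_wpM2l//.
  have la : `|lam * a i| <= lam * (c + eps) by rewrite normrM gtr0_norm// ler_pM2l.
  apply: le_trans (expR_le_quadratic _) _; first by lra.
  rewrite lerD2l -[X in X <= _]real_normK ?num_real// lerXn2r ?nnegrE//.
  by rewrite mulr_ge0 ?(ltW lam_gt0)// addr_ge0// ltW.
have -> : \sum_i w i * (1 + lam * a i + (lam * (c + eps)) ^+ 2) =
    1 + lam * (\sum_i w i * a i) + (lam * (c + eps)) ^+ 2.
  have -> : \sum_i w i * (1 + lam * a i + (lam * (c + eps)) ^+ 2) =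
    \sum_i ((1 + (lam * (c + eps)) ^+ 2) * w i + lam * (w i * a i)).
    by apply: eq_bigr => i _; ring.
  rewrite big_split/= -!mulr_sumr w_sum1; ring.
have : lam * (\sum_i w i * a i) <= lam * eps by rewrite ler_pM2l.
have -> : lam * (c + eps) = lam * c + (lam * c) ^+ 2 / 2 by rewrite epsE; ring.
have -> : lam * eps = (lam * c) ^+ 2 / 2 by rewrite epsE; ring.
move: lam_c lc0; set s := lam * c => s1 s0 h.
have : 0 <= s ^+ 2 * (1 - 4 * s) by rewrite mulr_ge0 ?sqr_ge0//; lra.
have : 0 <= s ^+ 3 * (1 - 4 * s) by rewrite mulr_ge0 ?exprn_ge0 ?(ltW s0)//; lra.
by move: h; rewrite !exprS !expr0 !mulr1; nra.
Qed.

End FiniteMgf.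

Section Cells.
Context {R : realType}.
Variables (k : outcome_kind) (A : set R) (f : R -> R -> R).
Hypothesis V : valid k A f.
Hypothesis slc : strictly_log_concave A f.

(** Difference quotients with steps [harmonic n] are measurable in [x] and converge pointwise to the
    score. *)
Lemma measurable_score y : measurable_fun A (score f ^~ y).
Proof.
pose q n x : R := (harmonic n)^-1 * (ln (f x (harmonic n *: 1 + y)) - ln (f x y)).
have ml z : measurable_fun A (fun x => ln (f x z)).
  by apply: (measurableT_comp (@measurable_ln R)); exact: valid_meas V z.
apply: (@measurable_fun_cvg _ _ _ _ q) => [n|x Ax].
  apply: measurable_funM; first exact: measurable_cst.
  by apply: measurable_funB; exact: ml.
have dx : derivable (fun z => ln (f x z)) y 1 by have [] := slc Ax y.
rewrite /score derive1E /derive.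
have /cvgr_dnbhsP/(_ harmonic) := dx; apply; split; last exact: cvg_harmonic.
by move=> n; rewrite gt_eqF// invr_gt0.
Qed.

Variables (M c lam : R).
Hypothesis score_le : forall x t, A x -> `|t| <= M -> `|score f x t| <= c.
Hypothesis c_gt0 : 0 < c.
Hypothesis lam_gt0 : 0 < lam.
Hypothesis lam_c : lam * c <= 4^-1.

(* Rounding the score by one mesh costs [(lam * c) ^+ 2 / 2] in the exponent, no more than the
   variance term. *)
Definition mesh : R := lam * c ^+ 2 / 2.
Definition cell_count : nat := (Num.trunc (2 * c / mesh)).+1.
(** The score is rounded down to [- c] plus a multiple of [mesh]; for [x] in [A] and [|y| <= M] the
    index is in range, so [inord] does not fall back on its default. *)
Definition cell (y x : R) : 'I_cell_count := inord (Num.trunc ((score f x y + c) / mesh)).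
Definition cell_value (i : 'I_cell_count) : R := - c + i%:R * mesh.
Definition cell_mass (y : R) (i : 'I_cell_count) : R :=
  fine (integral_over k (A `&` cell y @^-1` [set i]) (f ^~ y)).

Lemma mesh_gt0 : 0 < mesh.
Proof. by rewrite /mesh !mulr_gt0 ?invr_gt0 ?exprn_gt0. Qed.

Lemma cell_valueP x y : A x -> `|y| <= M ->
  cell_value (cell y x) <= score f x y <= cell_value (cell y x) + mesh.
Proof.
move=> Ax yM; have := score_le Ax yM; rewrite ler_norml => /andP[s1 s2].
have e0 := mesh_gt0.
have q0 : 0 <= (score f x y + c) / mesh by rewrite divr_ge0 ?(ltW e0)//; lra.
have lt : (Num.trunc ((score f x y + c) / mesh) < cell_count)%N.
  by rewrite ltnS le_truncn// ler_pM2r ?invr_gt0//; lra.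
rewrite /cell_value /cell inordK//.
have /andP[] := truncn_itv q0; set t := Num.trunc _.
rewrite ler_pdivlMr// ltr_pdivrMr// -natr1 mulrDl mul1r; lra.
Qed.

Lemma cell_value_le i : `|cell_value i| <= c.
Proof.
have e0 := mesh_gt0; have : i%:R * mesh <= 2 * c.
  rewrite -ler_pdivlMr//.
  have : (i <= Num.trunc (2 * c / mesh))%N by rewrite -ltnS.
  by rewrite truncn_ge_nat// divr_ge0 ?(ltW e0)// mulr_ge0// ltW.
have : 0 <= i%:R * mesh by rewrite mulr_ge0// ltW.
by rewrite /cell_value ler_norml; lra.
Qed.

Lemma measurable_cell y i : `|y| <= M -> measurable (A `&` cell y @^-1` [set i]).
Proof.
move=> yM; have mA := outcome_domain_measurable (valid_dom V).
have e0 := mesh_gt0.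
rewrite (_ : A `&` _ = A `&` (score f ^~ y) @^-1` `[cell_value i, cell_value i + mesh[%classic).
  by apply: measurable_score => //; exact: measurable_itv.
apply/seteqP; split => x [Ax /= H]; split => //=.
all: have := score_le Ax yM; rewrite ler_norml => /andP[s1 s2].
all: have q0 : 0 <= (score f x y + c) / mesh by rewrite divr_ge0 ?(ltW e0)//; lra.
all: have lt : (Num.trunc ((score f x y + c) / mesh) < cell_count)%N
  by rewrite ltnS le_truncn// ler_pM2r ?invr_gt0//; lra.
- rewrite in_itv/= -H /cell_value /cell inordK//.
  have /andP[] := truncn_itv q0; set t := Num.trunc _.
  rewrite ler_pdivlMr// ltr_pdivrMr// -natr1 mulrDl mul1r; lra.
- apply: val_inj; rewrite /cell /= inordK//; apply/eqP; rewrite truncn_eq//.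
  rewrite ler_pdivlMr// ltr_pdivrMr// -natr1 mulrDl mul1r.
  by move: H; rewrite in_itv/= /cell_value; lra.
Qed.

Lemma cell_mass_ge0 y i : 0 <= cell_mass y i.
Proof. by apply/fine_ge0/integral_over_ge0 => x [Ax _]; exact/ltW/(valid_pos V). Qed.

Lemma sum_integral_cell y z : `|y| <= M ->
  (\sum_i integral_over k (A `&` cell y @^-1` [set i]) (f ^~ z) = 1)%E.
Proof.
move=> yM; rewrite -(valid_mass V z) -integral_over_partition//.
- exact: outcome_domain_measurable (valid_dom V).
- exact: valid_meas V z.
- by move=> x Ax; exact/ltW/(valid_pos V).
- by move=> i; exact: measurable_cell.
Qed.

Lemma integral_cell_ge0 y z i :
  (0 <= integral_over k (A `&` cell y @^-1` [set i]) (f ^~ z))%E.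
Proof. by apply/integral_over_ge0 => x [Ax _]; exact/ltW/(valid_pos V). Qed.

Lemma integral_cellE y i : `|y| <= M ->
  (integral_over k (A `&` cell y @^-1` [set i]) (f ^~ y) = (cell_mass y i)%:E)%E.
Proof.
move=> yM; rewrite fineK// ge0_fin_numE ?integral_cell_ge0//.
apply: (@le_lt_trans _ _ 1%E); last exact: ltry.
rewrite -(sum_integral_cell y yM) (bigD1 i)//= leeDl// sume_ge0// => j _.
exact: integral_cell_ge0.
Qed.

Lemma sum_cell_mass y : `|y| <= M -> \sum_i cell_mass y i = 1.
Proof.
move=> yM; apply: EFin_inj; rewrite -sumEFin -(sum_integral_cell y yM).
by apply: eq_bigr => i _; rewrite integral_cellE.
Qed.

(* Integrates [f_tangent]: both [f ^~ y] and [f ^~ (y + t)] have mass 1. *)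
Lemma cell_tilt_ge1 y t (b : 'I_cell_count -> R) : `|y| <= M ->
  (forall x, A x -> t * score f x y <= b (cell y x)) ->
  1 <= \sum_i cell_mass y i * expR (b i).
Proof.
move=> yM hb; rewrite -lee_fin -(sum_integral_cell (y + t) yM) -sumEFin.
apply: lee_sum => i _; rewrite mulrC EFinM -integral_cellE//.
apply: le_integral_over_scale.
- exact: measurable_cell.
- by apply: measurable_funS (valid_meas V _) => //; exact: outcome_domain_measurable (valid_dom V).
- by apply: measurable_funS (valid_meas V _) => //; exact: outcome_domain_measurable (valid_dom V).
- by move=> x [Ax _]; exact/ltW/(valid_pos V).
- by move=> x [Ax _]; exact/ltW/(valid_pos V).
- exact: expR_ge0.
- move=> x [Ax /= cx]; apply: le_trans (f_tangent V slc y (y + t) Ax) _.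
  rewrite mulrC ler_pM2r ?(valid_pos V)// ler_expR addrAC subrr add0r mulrC -cx.
  exact: hb.
Qed.

(** The upper end of a cell exceeds the score by at most [mesh], so [cell_tilt_ge1] at [- t] gives
    the hypothesis of [mgf_le] with [eps := mesh]. *)
Lemma cell_mgf_pos y : `|y| <= M ->
  \sum_i cell_mass y i * expR (lam * (cell_value i + mesh)) <= expR (2 * (lam * c) ^+ 2).
Proof.
move=> yM; apply: (@mgf_le _ _ _ _ _ mesh) => //.
- by move=> i; exact: cell_mass_ge0.
- exact: sum_cell_mass.
- move=> i; apply: le_trans (ler_normD _ _) _.
  by rewrite (ger0_norm (ltW mesh_gt0)) lerD2r cell_value_le.
- move=> t t0; apply: (@cell_tilt_ge1 _ (- t)) => // x Ax.
  rewrite addrK !mulNr lerN2 ler_pM2l//.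
  by have /andP[] := cell_valueP Ax yM.
Qed.

(** For pairs read in reverse: the negated lower end of a cell dominates the negated score, again up
    to [mesh]. *)
Lemma cell_mgf_neg y : `|y| <= M ->
  \sum_i cell_mass y i * expR (lam * - cell_value i) <= expR (2 * (lam * c) ^+ 2).
Proof.
move=> yM; apply: (@mgf_le _ _ _ _ _ mesh) => //.
- by move=> i; exact: cell_mass_ge0.
- exact: sum_cell_mass.
- move=> i; rewrite normrN; apply: le_trans (cell_value_le i) _.
  by rewrite lerDl (ltW mesh_gt0).
- move=> t t0; apply: (@cell_tilt_ge1 _ t) => // x Ax.
  rewrite -opprD mulNr mulrN opprK ler_pM2l//.
  by have /andP[] := cell_valueP Ax yM.
Qed.

End Cells.

(** * Discretization of the sampling model *)

Section Discretization.
Context {R : realType} {d : measure_display} {Omega : measurableType d}.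
Variable P : probability Omega R.
Context {n : nat}.
Variables (k : outcome_kind) (A : set R) (f : R -> R -> R) (T : nat).
Variables (u : 'rV[R]_n) (p : 'I_n -> 'I_n -> R).
Variable N : 'I_n -> 'I_n -> {RV P >-> nat}.
Variable X : 'I_n -> 'I_n -> nat -> {RV P >-> R}.
Hypothesis model : sampling_model k A f T u p N X.

Variables (K : finType) (cellf : 'I_n * 'I_n -> R -> K) (mass : 'I_n * 'I_n -> K -> R).
Let cellset ij i := A `&` cellf ij @^-1` [set i].
Hypothesis measurable_cellset : forall ij i, measurable (cellset ij i).
Hypothesis integral_cellset : forall ij i,
  integral_over k (cellset ij i) (f ^~ (u 0 ij.1 - u 0 ij.2)) = (mass ij i)%:E.

Let lt_pair : pred ('I_n * 'I_n) := fun ij => (ij.1 < ij.2)%N.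
Let rate ij := p ij.1 ij.2.
Let W := @weight R _ K lt_pair T rate mass : {ffun _ -> record K T} -> R.
Let Conf : {pred {ffun 'I_n * 'I_n -> record K T}} := @configs _ K lt_pair T.
Implicit Types (x : {ffun 'I_n * 'I_n -> record K T}).

Let count_of x (i j : 'I_n) : nat := tag (x (i, j)).
(** The law of the outcomes takes boxes indexed by [nat]; [setT] is a default beyond the recorded
    count. *)
Let box_of x (i j : 'I_n) (t : nat) : set R :=
  if insub t is Some t' then cellset (i, j) (tagged (x (i, j)) t') else setT.

Definition config_event x : set Omega :=
  counts_are N (count_of x) `&` [set w | forall (i j : 'I_n) t,
    (i < j)%N -> (t < count_of x i j)%N -> box_of x i j t (X i j t w)].

Lemma config_eventP x w : config_event x w -> forall i j : 'I_n, (i < j)%N ->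
  N i j w = tag (x (i, j)) /\ forall t : 'I_(tag (x (i, j))),
    A (X i j t w) /\ cellf (i, j) (X i j t w) = tagged (x (i, j)) t.
Proof.
move=> [Nw Xw] i j ij; split=> [|t]; first exact: Nw.
have := Xw i j t ij (ltn_ord t); rewrite /box_of.
by case: insubP => [t' _ /val_inj ->|]; [case|rewrite ltn_ord].
Qed.

(** On an ordered pair the record is rebuilt from [w] and its count; elsewhere all entries are
    [no_record]. *)
Lemma config_event_inj x x' w : x \in Conf -> x' \in Conf ->
  config_event x w -> config_event x' w -> x = x'.
Proof.
move=> /pffun_onP[sx _] /pffun_onP[sx' _] ex ex'; apply/ffunP => -[i j].
have [ij|nij] := boolP (i < j)%N; last first.
  have out (y : {ffun _ -> record K T}) :
      (no_record K T).-support y \subset lt_pair -> y (i, j) = no_record K T.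
    move=> sy; apply/eqP; apply: contraNT nij => ne.
    exact: (fintype.subsetP sy (i, j) ne).
  by rewrite !out.
have [N1 X1] := config_eventP ex ij; have [N2 X2] := config_eventP ex' ij.
(* The type of the outcomes depends on the count. Writing both records as values of [F] reduces
   their equality to that of the counts, without transport. *)
pose F (c : 'I_T.+1) : record K T :=
  Tagged (fun c : 'I_T.+1 => {ffun 'I_c -> K}) [ffun t : 'I_c => cellf (i, j) (X i j t w)].
have FE (o : record K T) : (forall t : 'I_(tag o), cellf (i, j) (X i j t w) = tagged o t) ->
    o = F (tag o).
  case: o => c v /= H; rewrite /F; congr (Tagged _ _).
  by apply/ffunP => t; rewrite ffunE H.
rewrite (FE (x (i, j))) => [|t]; last by have [] := X1 t.
rewrite (FE (x' (i, j))) => [|t]; last by have [] := X2 t.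
by congr F; apply: val_inj; rewrite /= -N1 -N2.
Qed.

Lemma counts_areE c :
  counts_are N c = \bigcap_(ij in [set` [set ij : 'I_n * 'I_n | (ij.1 < ij.2)%N]%SET])
    (N ij.1 ij.2 @^-1` [set c ij.1 ij.2]).
Proof.
apply/seteqP; split => w H; first by move=> [i j] /=; rewrite inE => ij; exact: H.
by move=> i j ij; apply: (H (i, j)); rewrite /= inE.
Qed.

Lemma measurable_counts_are c : measurable (counts_are N c).
Proof.
rewrite counts_areE; apply: fin_bigcap_measurable => [|ij _].
  exact: finite_finset.
by rewrite -[X in measurable X]setTI; apply: measurable_funPT.
Qed.

Lemma prob_counts_are x :
  P (counts_are N (count_of x)) =
  (\prod_(ij | lt_pair ij) binomial_pmf T (rate ij) (tag (x ij)))%:E.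
Proof.
have [_ ind dist] := model_counts model.
rewrite counts_areE (ind _ (fun ij => [set count_of x ij.1 ij.2]))// -prodEFin.
apply: eq_big => [ij|[i j]]; rewrite ?inE//= => ij.
have := dist _ _ ij [set count_of x i j]; rewrite /distribution /pushforward => ->.
have ne : i != j by rewrite -val_eqE neq_ltn ij.
have [_ /andP[p0 p1]] := model_rates model ne.
rewrite /binomial_prob (ltW p0) p1 esum_set1// lee_fin.
by rewrite /binomial_pmf mulrn_wge0// mulr_ge0 ?exprn_ge0 ?(ltW p0)// subr_ge0.
Qed.

Lemma measurable_box x i j t : measurable (box_of x i j t).
Proof.
rewrite /box_of; case: insub => [t'|]; last exact: measurableT.
exact: measurable_cellset.
Qed.

Lemma measurable_config_event x : measurable (config_event x).
Proof.
apply: measurableI; first exact: measurable_counts_are.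
rewrite (_ : [set w | _] = \bigcap_(ij in [set: 'I_n * 'I_n]) \bigcap_(t in `I_(count_of x ij.1 ij.2))
    (if (ij.1 < ij.2)%N then X ij.1 ij.2 t @^-1` box_of x ij.1 ij.2 t else setT)).
  apply: fin_bigcap_measurable => [|[i j] _ /=]; first exact: finite_finset.
  apply: fin_bigcap_measurable => [|t _]; first exact: finite_II.
  by case: ifP => // _; apply: measurable_funPTI; exact: measurable_box.
apply/seteqP; split => w H.
  by move=> [i j] _ t /= tc; case: ifP => // ij; exact: H.
by move=> i j t ij tc; have := H (i, j) I t tc; rewrite /= ij.
Qed.

Lemma prob_config_event x : P (config_event x) = (W x)%:E.
Proof.
have [_ law] := model_outcomes model.
rewrite /config_event law => [|i j t]; last exact: measurable_box.
rewrite prob_counts_are /W /weight /record_weight big_split/= EFinM; congr (_ * _)%E.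
rewrite -prodEFin; apply: eq_bigr => -[i j] _ /=; rewrite -prodEFin.
apply: eq_bigr => t _; rewrite /box_of; case: insubP => [t' _ /val_inj ->|]; last by rewrite ltn_ord.
by rewrite setIA setIid integral_cellset.
Qed.

(** A finite disjoint union of configuration events stands in for the preimage under a map from
    [Omega] to configurations: a point with an observed outcome outside [A] has no configuration. *)
Lemma good_event (G : pred {ffun 'I_n * 'I_n -> record K T}) :
  exists E : set Omega,
    [/\ measurable E, P E = (\sum_(x in Conf | G x) W x)%:E &
        forall w, E w -> exists2 x, G x & config_event x w].
Proof.
exists (\bigcup_(x in [set x | (x \in Conf) && G x]) config_event x); split.
- by apply: fin_bigcup_measurable => [|x _]; [exact: finite_finset|exact: measurable_config_event].
- rewrite measure_fin_bigcup.
  + rewrite fsbig_finite/=; last exact: finite_finset.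
    under eq_bigr do rewrite prob_config_event.
    rewrite sumEFin -[in RHS]big_filter; congr EFin; apply: perm_big; apply: uniq_perm.
    * exact: finmap.fset_uniq.
    * by rewrite filter_uniq ?index_enum_uniq.
    * move=> x; rewrite mem_filter mem_index_enum andbT in_fset_set; last exact: finite_finset.
      by apply/idP/idP; rewrite inE.
  + exact: finite_finset.
  + move=> x x' /andP[cx _] /andP[cx' _] [w [ex ex']]; exact: config_event_inj ex ex'.
  + by move=> x _; exact: measurable_config_event.
- by move=> w [x /andP[_ Gx] ex]; exists x.
Qed.

End Discretization.

(** * Expansion and superlevel sets *)

Section Chain.
Context {R : realType} {n : nat}.
Implicit Types (a : 'I_n -> R) (x : R) (S : {set 'I_n}).

Definition superlevel a x : {set 'I_n} := [set i | x <= a i].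

Definition cut (e : 'I_n -> 'I_n -> R) S (S' : {set 'I_n}) : R :=
  \sum_(i in S) \sum_(j in S') e i j.

Variables (e : 'I_n -> 'I_n -> R) (alpha beta rho delta : R).
Hypothesis e_ge0 : forall i j, 0 <= e i j.
Hypothesis expansion : forall S, alpha * #|S|%:R * #|~: S|%:R <= cut e S (~: S).
Hypothesis degree_le : forall j, \sum_i e i j <= beta.
Hypothesis alpha_ge0 : 0 <= alpha.
Hypothesis beta_gt0 : 0 < beta.
Hypothesis rho_le : rho * beta <= alpha * n%:R / 4.
Hypothesis rho_ge0 : 0 <= rho.
Hypothesis delta_ge0 : 0 <= delta.

(** At least half of the cut of [S] ends in the new layer [S' :\: S]. By expansion this is at least
    [alpha * #|S| * n / 4], while each new point absorbs at most [beta]. *)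
Lemma superlevel_growth a x :
  cut e (superlevel a x) (~: superlevel a (x - delta)) <=
    2^-1 * cut e (superlevel a x) (~: superlevel a x) ->
  (2 * #|superlevel a x| <= n)%N ->
  (1 + rho) * #|superlevel a x|%:R <= #|superlevel a (x - delta)|%:R :> R.
Proof.
set S := superlevel a x; set S' := superlevel a (x - delta) => half small.
have sub : S \subset S' by apply/fintype.subsetP => i; rewrite !inE; move: delta_ge0; lra.
have splitS : cut e S (~: S) = cut e S (~: S') + cut e S (S' :\: S).
  rewrite /cut -big_split/=; apply: eq_bigr => i _.
  rewrite (big_setID S')/= addrC; congr (_ + _); apply: eq_bigl => j.
    rewrite !inE; have /implyP := fintype.subsetP sub j; rewrite !inE.
    by do 2!case: (_ <= a j).
  by rewrite !inE andbC.
have up : cut e S (S' :\: S) <= beta * #|S' :\: S|%:R.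
  rewrite /cut exchange_big/= mulr_natr -sumr_const; apply: ler_sum => j _.
  apply: le_trans (degree_le j); rewrite [leLHS]big_mkcond/=.
  by apply: ler_sum => i _; case: ifP.
have := expansion S; rewrite (cardsCs (~: S)) finset.setCK card_ord => ex.
have cS' : #|S'|%:R = #|S|%:R + #|S' :\: S|%:R :> R.
  by rewrite -natrD -(cardsID S S') (finset.setIidPr sub).
have half_n : n%:R / 2 <= (n - #|S|)%:R :> R.
  by rewrite natrB ?(leq_trans _ small) ?leq_pmull//; move: small; rewrite -(ler_nat R) natrM; lra.
have low : alpha * #|S|%:R * (n%:R / 2) <= cut e S (~: S).
  by apply: le_trans ex; rewrite ler_wpM2l// mulr_ge0.
have : beta * (rho * #|S|%:R) <= beta * #|S' :\: S|%:R.
  apply: le_trans up.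
  have : rho * beta * #|S|%:R <= alpha * n%:R / 4 * #|S|%:R by rewrite ler_wpM2r.
  move: low half; rewrite splitS; lra.
by rewrite ler_pM2l// cS'; lra.
Qed.

Lemma superlevel_majority a (k : nat) i0 :
  (forall x, cut e (superlevel a x) (~: superlevel a (x - delta)) <=
    2^-1 * cut e (superlevel a x) (~: superlevel a x)) ->
  n%:R < (1 + rho) ^+ k ->
  (n < 2 * #|superlevel a (a i0 - delta *+ k)|)%N.
Proof.
move=> half nk.
(* Induction with two alternatives: a majority is reached, and persists as the level drops, or every
   step so far brought growth; [k] steps of growth would exceed [n]. *)
have /orP[//|] : (n < 2 * #|superlevel a (a i0 - delta *+ k)|)%N ||
    ((1 + rho) ^+ k <= #|superlevel a (a i0 - delta *+ k)|%:R); last first.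
  move/(lt_le_trans nk); rewrite ltr_nat => /leq_trans/(_ (max_card _)).
  by rewrite card_ord ltnn.
elim: k {nk} => [|k /orP[IH|IH]].
- apply/orP; right; rewrite expr0 mulr0n subr0 ler1n card_gt0.
  by apply/set0Pn; exists i0; rewrite inE.
- apply/orP; left; apply: leq_trans IH _; rewrite leq_mul2l/= subset_leq_card//.
  by apply/fintype.subsetP => i; rewrite !inE mulrS; move: delta_ge0; lra.
- have [//|small] := ltnP n (2 * #|superlevel a (a i0 - delta *+ k.+1)|).
  rewrite /= exprS mulrSr opprD addrA.
  apply: le_trans (superlevel_growth (half _) _).
    by rewrite ler_wpM2l// addr_ge0.
  apply: leq_trans small; rewrite leq_mul2l/= subset_leq_card//.
  by apply/fintype.subsetP => i; rewrite !inE mulrS; move: delta_ge0; lra.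
Qed.

(** Majorities reached from [a i] downwards and from [a j] upwards share a point [l], for which [a i
    - delta *+ k <= a l <= a j + delta *+ k]. *)
Lemma spread_le a (k : nat) :
  (forall x, cut e (superlevel a x) (~: superlevel a (x - delta)) <=
    2^-1 * cut e (superlevel a x) (~: superlevel a x)) ->
  (forall x, cut e (superlevel (fun i => - a i) x) (~: superlevel (fun i => - a i) (x - delta)) <=
    2^-1 * cut e (superlevel (fun i => - a i) x) (~: superlevel (fun i => - a i) x)) ->
  n%:R < (1 + rho) ^+ k ->
  forall i j, a i - a j <= 2 * (delta *+ k).
Proof.
move=> up down nk i j.
have Hi := superlevel_majority i up nk.
have Hj := superlevel_majority j down nk.
set S := superlevel a _ in Hi; set S' := superlevel _ _ in Hj.
have : (0 < #|S :&: S'|)%N.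
  rewrite lt0n; apply/negP => /eqP I0.
  have := max_card (S :|: S'); rewrite cardsU I0 subn0 card_ord => H.
  by have := leq_add Hi Hj; rewrite -mulnDr => /leq_trans/(_ (leq_mul (leqnn 2) H)); lia.
rewrite card_gt0 => /set0Pn[l]; rewrite !inE => /andP[]; lra.
Qed.

End Chain.

(** * First-order condition on superlevel sets *)

Lemma finite_min_gt0 (R : realType) (I : finType) (P : pred I) (F : I -> R) :
  (forall i, P i -> 0 < F i) -> exists2 eps : R, 0 < eps & forall i, P i -> eps <= F i.
Proof.
move=> F0; exists (\big[Num.min/1]_(i | P i) F i).
  by elim/big_ind : _ => // x y x0 y0; rewrite lt_min x0.
by move=> i Pi; rewrite (bigD1 i)//= ge_min lexx.
Qed.

Section Objective.
Context {R : realType} {n : nat}.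

Definition objective (D : 'I_n -> 'I_n -> R -> R) (v : 'I_n -> R) : R :=
  \sum_(ij : 'I_n * 'I_n | ij.1 != ij.2) D ij.1 ij.2 (v ij.1 - v ij.2).

(** Only pairs across the boundary of [S] change, and [objective] counts each of them in both
    orders, which the symmetry of [D] identifies: hence the factor 2. *)
Lemma objective_move D (S : {set 'I_n}) (v : 'I_n -> R) eps :
  (forall i j y, i != j -> D i j y = D j i (- y)) ->
  objective D (fun i => v i - eps *+ (i \in S)) - objective D v =
  2 * \sum_(i in S) \sum_(j in ~: S) (D i j (v i - v j - eps) - D i j (v i - v j)).
Proof.
move=> Dsym; set v' := fun i => _.
pose F i j := D i j (v' i - v' j) - D i j (v i - v j).
have -> : objective D v' - objective D v = \sum_i \sum_(j | i != j) F i j.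
  by rewrite /objective -sumrB pair_big_dep.
have F0 i j : (i \in S) = (j \in S) -> F i j = 0.
  by rewrite /F /v' => ->; rewrite [_ - _ in X in D _ _ X](_ : _ = v i - v j) ?subrr//; ring.
have FS i : \sum_(j | i != j) F i j = \sum_(j | (j \in S) != (i \in S)) F i j.
  rewrite big_mkcond [RHS]big_mkcond; apply: eq_bigr => j _.
  have [->|ij] := eqVneq i j; first by rewrite eqxx.
  by case: eqP => // /esym /F0.
under eq_bigr do rewrite FS.
rewrite (bigID (mem S))/=.
have -> : \sum_(i in S) \sum_(j | (j \in S) != (i \in S)) F i j =
    \sum_(i in S) \sum_(j in ~: S) (D i j (v i - v j - eps) - D i j (v i - v j)).
  apply: eq_bigr => i iS; apply: eq_big => j; rewrite ?inE iS; case jS: (j \in S) => //= _.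
  rewrite /F /v' iS jS mulr1n mulr0n; congr (D _ _ _ - _); ring.
rewrite mulr_natl mulr2n; congr (_ + _).
have -> : \sum_(i in S) \sum_(j in ~: S) (D i j (v i - v j - eps) - D i j (v i - v j)) =
    \sum_(j in S) \sum_(i | i \notin S) F i j.
  apply: eq_bigr => j jS; apply: eq_big => i; rewrite ?inE// => iS.
  have ij : i != j by apply: contraNneq iS => ->.
  by rewrite /F /v' jS (negbTE iS) mulr1n mulr0n !(Dsym i j)//; congr (D _ _ _ - D _ _ _); ring.
rewrite exchange_big/=; apply: eq_bigr => i iS.
by apply: eq_bigl => j; rewrite (negbTE iS); case: (j \in S).
Qed.

End Objective.

Section CutHalf.
Context {R : realType} {n : nat}.
Variables (D g : 'I_n -> 'I_n -> R -> R) (e : 'I_n -> 'I_n -> R) (u uh : 'I_n -> R).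
Variables (c3 kappa delta r : R).
Hypothesis Dsym : forall i j y, i != j -> D i j y = D j i (- y).
Hypothesis Dtangent : forall i j y z, i != j -> D i j z <= D i j y + g i j y * (z - y).
Hypothesis g_decay : forall i j z, i != j -> 0 <= z ->
  g i j (u i - u j + z) <= g i j (u i - u j) - c3 * e i j * Num.min z 1.
Hypothesis e_ge0 : forall i j, 0 <= e i j.
Hypothesis c3_gt0 : 0 < c3.
Hypothesis delta01 : 0 < delta <= 1.
Hypothesis c3_delta : c3 * delta = 2 * kappa.
Hypothesis score_le : forall S : {set 'I_n},
  cut (fun i j => g i j (u i - u j)) S (~: S) <= kappa * cut e S (~: S).
Hypothesis uh_spread : forall i j, (uh i - u i) - (uh j - u j) <= r.
Hypothesis uh_max : forall v : 'I_n -> R, (forall i j, (v i - u i) - (v j - u j) <= r) ->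
  objective D v <= objective D uh.

Let a i := uh i - u i.

Lemma cut_half x :
  cut e (superlevel a x) (~: superlevel a (x - delta)) <=
    2^-1 * cut e (superlevel a x) (~: superlevel a x).
Proof.
set S := superlevel a x; set S' := superlevel a (x - delta).
have /andP[delta0 delta1] := delta01.
(* The shift has to fit into two gaps: after it, the points of [S] still lie above those outside
   [S], and above those outside [S'] by at least [delta]. *)
have [eps1 eps1_gt0 Heps1] : exists2 eps : R, 0 < eps & forall j, j \notin S -> eps <= x - a j.
  by apply: finite_min_gt0 => j; rewrite inE -ltNge subr_gt0.
have [eps2 eps2_gt0 Heps2] : exists2 eps : R, 0 < eps & forall j, j \notin S' -> eps <= x - delta - a j.
  by apply: finite_min_gt0 => j; rewrite inE -ltNge subr_gt0.
pose eps := Num.min eps1 eps2.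
have eps_gt0 : 0 < eps by rewrite lt_min eps1_gt0.
have eps_le1 j : j \notin S -> a j + eps <= x.
  have : eps <= eps1 by rewrite ge_min lexx.
  by move=> + /Heps1; lra.
have eps_le2 j : j \notin S' -> a j + eps + delta <= x.
  have : eps <= eps2 by rewrite ge_min lexx orbT.
  by move=> + /Heps2; lra.
have aS i : i \in S -> x <= a i by rewrite inE.
(* Lowering [S] by [eps] is admissible, as it reverses no order across the cut, so it cannot raise
   the objective. Tangents at the lowered differences turn this into a sign without a limit in
   [eps]. *)
have score_ge0 : 0 <= cut (fun i j => g i j (uh i - uh j - eps)) S (~: S).
  have /uh_max : forall i j, (uh i - eps *+ (i \in S) - u i) - (uh j - eps *+ (j \in S) - u j) <= r.
    move=> i j; have := uh_spread i j.
    case iS : (i \in S); case jS : (j \in S); rewrite ?mulr1n ?mulr0n; try lra.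
    move: (eps_le1 i) (aS j) (uh_spread i i); rewrite iS jS /a => /(_ isT) + /(_ isT); lra.
  rewrite -subr_le0 objective_move// pmulr_rle0 ?ltr0n// => H.
  rewrite -(pmulr_rge0 _ eps_gt0) -oppr_le0; apply: le_trans H.
  rewrite mulr_sumr -sumrN; apply: ler_sum => i iS.
  rewrite mulr_sumr -sumrN; apply: ler_sum => j; rewrite inE => jS.
  have ij : i != j by apply: contraNneq jS => <-.
  by have := Dtangent (uh i - uh j - eps) (uh i - uh j) ij; lra.
(* No pair across the cut gains over its score at [u], and those ending outside [S'] lose
   [c3 * delta] per unit of [e]. *)
have decay : cut (fun i j => g i j (uh i - uh j - eps)) S (~: S) <=
   cut (fun i j => g i j (u i - u j)) S (~: S) - c3 * delta * cut e S (~: S').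
  have -> : cut e S (~: S') = \sum_(i in S) \sum_(j in ~: S) e i j *+ (j \in ~: S').
    apply: eq_bigr => i iS; rewrite [RHS]big_mkcond [LHS]big_mkcond; apply: eq_bigr => j _.
    rewrite !inE; have [hx|hx] := leP x (a j); have [hd|hd] := leP (x - delta) (a j) => //=.
    by exfalso; move: delta0 hx hd; lra.
  rewrite mulr_sumr -sumrB; apply: ler_sum => i iS.
  rewrite mulr_sumr -sumrB; apply: ler_sum => j; rewrite inE => jS.
  have ij : i != j by apply: contraNneq jS => <-.
  have z0 : 0 <= a i - a j - eps by have := eps_le1 j jS; have := aS i iS; lra.
  have -> : uh i - uh j - eps = u i - u j + (a i - a j - eps) by rewrite /a; ring.
  apply: le_trans (g_decay ij z0) _; rewrite lerD2l lerN2 -mulrA -[leRHS]mulrA.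
  rewrite ler_wpM2l ?(ltW c3_gt0)// mulrC; case jS' : (j \in ~: S').
    rewrite mulr1n ler_wpM2l// le_min delta1 andbT.
    by move: jS'; rewrite inE => /eps_le2; have := aS i iS; lra.
  by rewrite mulr0n mul0r mulr_ge0// le_min z0 ler01.
have := score_le S; have := score_ge0; move: decay; rewrite c3_delta => d1 d2 d3.
have k0 : 0 < kappa by have := mulr_gt0 c3_gt0 delta0; rewrite c3_delta; lra.
have : kappa * (2 * cut e S (~: S')) <= kappa * cut e S (~: S) by lra.
by rewrite ler_pM2l//; lra.
Qed.

End CutHalf.

(** * Existence and uniqueness of the maximizer *)

Lemma cutC (R : realType) n (e : 'I_n -> 'I_n -> R) (S : {set 'I_n}) :
  cut e S (~: S) = cut (fun i j => e j i) (~: S) S.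
Proof. by rewrite /cut exchange_big. Qed.

Lemma coord_diff_continuous (R : realType) n (i j : 'I_n) :
  continuous (fun v : 'rV[R]_n => v 0 i - v 0 j).
Proof.
move=> v; exact: (@cvgB _ _ _ _ _ (fun v : 'rV[R]_n => v 0 i) (fun v : 'rV[R]_n => v 0 j) _ _
  (@coord_continuous _ _ _ 0 i v) (@coord_continuous _ _ _ 0 j v)).
Qed.

Section ConcaveObjective.
Context {R : realType} {n : nat}.
Variables (D g : 'I_n -> 'I_n -> R -> R) (e : 'I_n -> 'I_n -> R).
Hypothesis Dtangent : forall i j y z, i != j -> D i j z <= D i j y + g i j y * (z - y).
Hypothesis Dstrict : forall i j y z, i != j -> 0 < e i j -> y != z ->
  D i j z < D i j y + g i j y * (z - y).
Implicit Types (v w : 'I_n -> R).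

Lemma objective_concave v w (s : R) : 0 <= s <= 1 ->
  (1 - s) * objective D v + s * objective D w <=
  objective D (fun i => v i + s * (w i - v i)).
Proof.
move=> /andP[s0 s1]; rewrite /objective !mulr_sumr -big_split/=.
apply: ler_sum => -[i j]/= ij; set m := _ - (_ + _ : R).
have := Dtangent m (v i - v j) ij; have := Dtangent m (w i - w j) ij.
rewrite (_ : w i - w j - m = (1 - s) * ((w i - v i) - (w j - v j))); last by rewrite /m; ring.
rewrite (_ : v i - v j - m = - s * ((w i - v i) - (w j - v j))); last by rewrite /m; ring.
move=> /(ler_wpM2l s0) h1 /(ler_wpM2l (_ : 0 <= 1 - s)) h2.
have {}h2 := h2 (_ : is_true (0 <= 1 - s)).
apply: le_trans (lerD (h2 _) h1) _; first by rewrite subr_ge0.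
by rewrite le_eqVlt; apply/orP; left; apply/eqP; ring.
Qed.

Lemma objective_strictly_concave v w i j : i != j -> 0 < e i j ->
  v i - v j != w i - w j ->
  2^-1 * (objective D v + objective D w) < objective D (fun i => v i + 2^-1 * (w i - v i)).
Proof.
move=> ij eij vw; rewrite /objective -big_split/= mulr_sumr.
have half k l : k != l ->
    2^-1 * (D k l (v k - v l) + D k l (w k - w l)) <=
    D k l (v k + 2^-1 * (w k - v k) - (v l + 2^-1 * (w l - v l))).
  move=> kl; set m := _ - (_ + _ : R).
  have := Dtangent m (v k - v l) kl; have := Dtangent m (w k - w l) kl.
  rewrite (_ : w k - w l - m = - (v k - v l - m)); last by rewrite /m; field.
  by rewrite mulrN; lra.
rewrite (bigD1 (i, j))//= [ltRHS](bigD1 (i, j))//=.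
apply: ltr_leD; last by apply: ler_sum => -[k l] /andP[/= kl _]; exact: half.
set m := _ - (_ + _ : R).
have mv : m != v i - v j.
  by apply: contra_neq vw; rewrite /m => h; lra.
have := Dstrict ij eij mv; have := Dtangent m (w i - w j) ij.
rewrite (_ : w i - w j - m = - (v i - v j - m)); last by rewrite /m; field.
by rewrite mulrN; lra.
Qed.

End ConcaveObjective.

Section MaximumLikelihood.
Context {R : realType} {n : nat}.
Variables (D g : 'I_n -> 'I_n -> R -> R) (e : 'I_n -> 'I_n -> R) (u : 'rV[R]_n).
Variables (c3 kappa delta alpha beta rho : R) (k : nat) (i0 : 'I_n).
Hypothesis i0E : i0 = 0 :> nat.
Hypothesis u_normalized : normalized u.
Hypothesis Dsym : forall i j y, i != j -> D i j y = D j i (- y).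
Hypothesis gsym : forall i j y, i != j -> g i j y = - g j i (- y).
Hypothesis Dcont : forall i j, i != j -> continuous (D i j).
Hypothesis Dtangent : forall i j y z, i != j -> D i j z <= D i j y + g i j y * (z - y).
Hypothesis Dstrict : forall i j y z, i != j -> 0 < e i j -> y != z ->
  D i j z < D i j y + g i j y * (z - y).
Hypothesis g_decay : forall i j z, i != j -> 0 <= z ->
  g i j (u 0 i - u 0 j + z) <= g i j (u 0 i - u 0 j) - c3 * e i j * Num.min z 1.
Hypothesis e_ge0 : forall i j, 0 <= e i j.
Hypothesis e_sym : forall i j, e i j = e j i.
Hypothesis c3_gt0 : 0 < c3.
Hypothesis delta01 : 0 < delta <= 1.
Hypothesis c3_delta : c3 * delta = 2 * kappa.
Hypothesis score_le : forall S : {set 'I_n},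
  cut (fun i j => g i j (u 0 i - u 0 j)) S (~: S) <= kappa * cut e S (~: S).
Hypothesis expansion : forall S : {set 'I_n}, alpha * #|S|%:R * #|~: S|%:R <= cut e S (~: S).
Hypothesis degree_le : forall j, \sum_i e i j <= beta.
Hypothesis alpha_gt0 : 0 < alpha.
Hypothesis beta_gt0 : 0 < beta.
Hypothesis rho_le : rho * beta <= alpha * n%:R / 4.
Hypothesis rho_ge0 : 0 <= rho.
Hypothesis growth_k : n%:R < (1 + rho) ^+ k.

Let obj (v : 'rV[R]_n) := objective D (v 0).
Let spread_in r (v : 'rV[R]_n) := forall i j, (v 0 i - u 0 i) - (v 0 j - u 0 j) <= r.

Lemma maximizer_spread r (uh : 'rV[R]_n) :
  spread_in r uh ->
  (forall v : 'I_n -> R, (forall i j, (v i - u 0 i) - (v j - u 0 j) <= r) ->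
    objective D v <= obj uh) ->
  spread_in (2 * (delta *+ k)) uh.
Proof.
move=> sp mx; have /andP[/ltW d0 _] := delta01.
apply: (spread_le e_ge0 expansion degree_le (ltW alpha_gt0) beta_gt0 rho_le rho_ge0 d0) => // x.
  exact: (cut_half (r := r) Dsym Dtangent g_decay e_ge0 c3_gt0 delta01 c3_delta score_le).
(* Reflection exchanges maximum and minimum: [- uh] maximizes the reflected objective, so [cut_half]
   also applies from below. *)
pose D' i j y := D i j (- y); pose g' i j y := - g i j (- y).
have objN v : objective D' (fun i => - v i) = objective D v.
  by apply: eq_bigr => -[i j] _ /=; rewrite /D' !opprB opprK addrC.
have objN' v : objective D' v = objective D (fun i => - v i).
  by apply: eq_bigr => -[i j] _ /=; rewrite /D' opprB opprK addrC.
have -> : (fun i => - (uh 0 i - u 0 i)) = (fun i => (- uh 0 i) - (- u 0 i)).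
  by apply/funext => i; rewrite opprB opprK addrC.
apply: (@cut_half _ _ D' g' e (fun i => - u 0 i) (fun i => - uh 0 i) c3 kappa delta r) => //.
- by move=> i j y ij; rewrite /D' Dsym.
- by move=> i j y z ij; rewrite /D' /g'; have := Dtangent (- y) (- z) ij; lra.
- move=> i j z ij z0; rewrite /g'.
  have := g_decay (_ : j != i) z0; rewrite eq_sym => /(_ ij).
  rewrite !(gsym _ ij) !opprK (e_sym j i).
  by rewrite (_ : u 0 j - u 0 i = - u 0 i + u 0 j)//; ring.
- move=> S; rewrite cutC [in leRHS]cutC.
  have := score_le (~: S); rewrite finset.setCK.
  have -> : cut e (~: S) S = cut (fun i j => e j i) (~: S) S.
    by apply: eq_bigr => i _; apply: eq_bigr => j _; exact: e_sym.
  apply: le_trans; apply: ler_sum => i iS; apply: ler_sum => j jS.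
  have ij : i != j by apply: contraTneq jS => <-; rewrite inE in iS.
  by rewrite (gsym _ ij) /g' le_eqVlt; apply/orP; left; apply/eqP; congr (- g _ _ _); ring.
- by move=> i j; have := sp j i; lra.
- by move=> v vr; rewrite objN' objN; apply: mx => i j; have := vr j i; lra.
Qed.

Lemma objective_continuous : continuous obj.
Proof.
move=> v; rewrite /obj /objective.
apply: cvg_big; [exact: add_continuous|exact: nbhs_filter|move=> [i j]/= ij].
apply: (@continuous_comp _ _ _ (fun v : 'rV[R]_n => v 0 i - v 0 j) (D i j)); last exact: Dcont.
exact: coord_diff_continuous.
Qed.

Lemma restricted_maximizer r : 0 <= r -> exists uh : 'rV[R]_n,
  [/\ normalized uh, spread_in r uh &
      forall v : 'I_n -> R, (forall i j, (v i - u 0 i) - (v j - u 0 j) <= r) ->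
        objective D v <= obj uh].
Proof.
move=> r0; pose A := [set v : 'rV[R]_n | normalized v /\ spread_in r v].
have A0 : A !=set0.
  by exists u; split => // i j; rewrite !subrr.
have cA : compact A.
  apply: bounded_closed_compact.
    exists (`|u| + r); split; first exact: num_real.
    move=> M uM v [vn vr] /=; rewrite -[v](subrK u) addrC.
    apply: (le_trans (ler_normD _ _)); apply: (le_trans _ (ltW uM)); rewrite lerD2l.
    rewrite -[leLHS]/(mx_norm _) mx_normrE; apply: bigmax_le => // -[i j] _ /=; rewrite !mxE (ord1 i).
    have := vr j i0; have := vr i0 j; rewrite (vn _ i0E) (u_normalized i0E) !subrr subr0 sub0r.
    by rewrite ler_norml; lra.
  have -> : A = (\bigcap_(i in [set i : 'I_n | i = 0 :> nat]) [set v : 'rV[R]_n | v 0 i = 0]) `&`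
     \bigcap_(ij in [set: 'I_n * 'I_n])
       [set v : 'rV[R]_n | v 0 ij.1 - v 0 ij.2 <= r + (u 0 ij.1 - u 0 ij.2)].
    apply/seteqP; split => v [vn vr]; split => //=.
      by move=> [i j] _ /=; have := vr i j; lra.
      by move=> i j; have := vr (i, j) I; rewrite /=; lra.
  apply: closedI; apply: closed_bigI => i _.
    apply: (@preimage_closed _ _ (fun v : 'rV[R]_n => v 0 i) [set 0]); last exact: closed_eq.
    by move=> v _; exact: coord_continuous.
  apply: (@preimage_closed _ _ (fun v : 'rV[R]_n => v 0 i.1 - v 0 i.2)
    [set x | x <= r + (u 0 i.1 - u 0 i.2)]); last exact: closed_le.
  by move=> v _; exact: coord_diff_continuous.
have [|uh] := compact_EVT_max A0 cA (f := obj).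
  exact/continuous_subspaceT/objective_continuous.
rewrite inE => -[uhn uhr] mx; exists uh; split => // v vr.
(* The objective depends on differences only, so this normalizes a competitor without changing its
   value or its spread. *)
pose v' : 'rV[R]_n := \row_i (v i - v i0).
have -> : objective D v = obj v'.
  by apply: eq_bigr => -[i j] _ /=; congr (D _ _ _); rewrite !mxE; ring.
apply: mx; rewrite inE; split => [i ie|i j].
  have -> : i = i0 by apply/val_inj; rewrite /= i0E.
  by rewrite mxE subrr.
by rewrite !mxE; have := vr i j; lra.
Qed.

Lemma unique_maximizer : exists uh : 'rV[R]_n,
  unique (fun v : 'rV[R]_n => normalized v /\
    forall v' : 'rV[R]_n, normalized v' -> obj v' <= obj v) uh /\
  `|uh - u| <= 2 * (delta *+ k).
Proof.
have /andP[d0 _] := delta01.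
have b0 : 0 <= 2 * (delta *+ k) by rewrite mulr_ge0// mulrn_wge0// ltW.
(* One more than the spread that [maximizer_spread] guarantees, so that the constraint is inactive
   at [uh]. *)
pose r := 2 * (delta *+ k) + 1.
have [|uh [uhn uhr uhmax]] := @restricted_maximizer r; first by rewrite addr_ge0.
have sp := maximizer_spread uhr uhmax.
have uh_global v : objective D v <= obj uh.
  pose B := \sum_(ij : 'I_n * 'I_n) `|(v ij.1 - uh 0 ij.1) - (v ij.2 - uh 0 ij.2)|.
  have B0 : 0 <= B by apply: sumr_ge0.
  (* Moving by the fraction [s] towards [v] changes the spread by at most 1 and stays admissible;
     concavity along the segment then compares [v] itself with [uh]. *)
  pose s := (1 + B)^-1.
  have s0 : 0 < s by rewrite invr_gt0; lra.
  have s1 : s <= 1 by rewrite invf_le1; lra.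
  have sB : s * B <= 1 by rewrite mulrC ler_pdivrMr; lra.
  have s01 : 0 <= s <= 1 by rewrite ltW.
  have := objective_concave Dtangent (uh 0) v s01.
  have /uhmax : forall i j, (uh 0 i + s * (v i - uh 0 i) - u 0 i) -
     (uh 0 j + s * (v j - uh 0 j) - u 0 j) <= r.
    move=> i j; have := sp i j.
    have : s * ((v i - uh 0 i) - (v j - uh 0 j)) <= s * B.
      rewrite ler_pM2l// (le_trans (ler_norm _))// /B (bigD1 (i, j))//= lerDl.
      exact: sumr_ge0.
    by rewrite /r; lra.
  move=> h1 /le_trans/(_ h1); rewrite /obj => h2.
  rewrite -(ler_pM2l s0); move: h2; rewrite mulrBl mul1r; lra.
exists uh; split; last first.
  rewrite -[leLHS]/(mx_norm _) mx_normrE; apply: bigmax_le => // -[i j] _ /=; rewrite !mxE (ord1 i).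
  have := sp j i0; have := sp i0 j; rewrite (uhn _ i0E) (u_normalized i0E) !subrr subr0 sub0r.
  by rewrite ler_norml; lra.
split; first by split => // v' _; exact: uh_global.
move=> v [vn vmax]; apply/rowP => j; apply/eqP; apply: contraT => vj.
(* By expansion some comparison joins a point where the two maximizers agree to one where they
   differ; strict concavity there makes their midpoint beat the average of the two values. *)
pose S : {set 'I_n} := [set i | v 0 i == uh 0 i]%SET.
have S0 : (0 < #|S|)%N.
  by rewrite card_gt0; apply/set0Pn; exists i0; rewrite inE (vn _ i0E) (uhn _ i0E).
have S1 : (0 < #|~: S|)%N.
  by rewrite card_gt0; apply/set0Pn; exists j; rewrite !inE eq_sym.
have : 0 < cut e S (~: S) by apply: lt_le_trans (expansion S); rewrite !mulr_gt0 ?ltr0n.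
case: (pickP (fun ij : 'I_n * 'I_n => [&& ij.1 \in S, ij.2 \in ~: S & 0 < e ij.1 ij.2])).
  move=> [i l] /= /and3P[iS lS eil] _.
  have il : i != l by apply: contraTneq lS => <-; rewrite inE iS.
  have := @objective_strictly_concave _ _ _ _ _ Dtangent Dstrict (uh 0) (v 0) i l il eil.
  move: iS lS; rewrite !inE => /eqP -> vl.
  have ne : uh 0 i - uh 0 l != uh 0 i - v 0 l.
    by apply: contraNneq vl => /addrI /oppr_inj ->.
  move/(_ ne); rewrite ltNge => /negP; case.
  have := vmax _ uhn; have := uh_global (fun i => uh 0 i + 2^-1 * (v 0 i - uh 0 i)).
  by rewrite /obj; lra.
move=> none; rewrite lt_neqAle => /andP[/eqP ne _]; exfalso; apply: ne; apply/esym.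
rewrite /cut big1// => i iS; rewrite big1// => l lS.
have := none (i, l); rewrite /= iS lS/= => /negbT; rewrite -leNgt => h.
by apply/le_anti; rewrite h e_ge0.
Qed.

End MaximumLikelihood.

(** * Cuts of the comparison graph *)

Definition ordered_pair {n} : pred ('I_n * 'I_n) := fun ij => (ij.1 < ij.2)%N.

(** Only pairs with [i < j] carry a record, whereas cuts are directed: [x] is for a pair leaving
    [S], [y] for one entering it. *)
Definition across {n} {V : Type} (S : {set 'I_n}) (ij : 'I_n * 'I_n) (x y z : V) : V :=
  if (ij.1 \in S) && (ij.2 \notin S) then x
  else if (ij.2 \in S) && (ij.1 \notin S) then y else z.

Section Across.
Context {R : realType} {n : nat}.
Implicit Types (S : {set 'I_n}).

Lemma cut_across (F : 'I_n -> 'I_n -> R) S :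
  cut F S (~: S) = \sum_(ij | ordered_pair ij) across S ij (F ij.1 ij.2) (F ij.2 ij.1) 0.
Proof.
pose G (ij : 'I_n * 'I_n) := if (ij.1 \in S) && (ij.2 \notin S) then F ij.1 ij.2 else 0.
transitivity (\sum_ij G ij).
  rewrite -(pair_bigA _ (fun i j => G (i, j)))/= /cut big_mkcond/=; apply: eq_bigr => i _.
  rewrite /G/=; case: ifP => iS; last by rewrite big1.
  by rewrite big_mkcond/=; apply: eq_bigr => j _; rewrite inE.
rewrite (bigID ordered_pair)/=.
have -> : \sum_(ij | ~~ ordered_pair ij) G ij = \sum_(ij | ordered_pair ij) G (ij.2, ij.1).
  rewrite (bigID (fun ij => ij.1 == ij.2))/= big1 ?add0r => [|[i j]/= /andP[_ /eqP ->]].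
    rewrite (reindex_inj (h := fun ij : 'I_n * 'I_n => (ij.2, ij.1)))/=; last first.
      by move=> [i j] [i' j'] [-> ->].
    by apply: eq_bigl => -[i j]; rewrite /ordered_pair/= -leqNgt ltn_neqAle andbC -val_eqE eq_sym.
  by rewrite /G/= andbN.
rewrite -big_split/=; apply: eq_bigr => -[i j] _; rewrite /G /across/=.
by case: (i \in S); case: (j \in S); rewrite /= ?addr0 ?add0r.
Qed.

Lemma sum_across1 S :
  \sum_(ij | ordered_pair ij) across S ij 1 1 0 = #|S|%:R * #|~: S|%:R :> R.
Proof.
rewrite -(cut_across (fun _ _ => 1)) /cut.
under eq_bigr do rewrite sumr_const.
by rewrite sumr_const mulr_natl.
Qed.

End Across.

(** * Chernoff and union bounds over cuts *)

Section CutChernoff.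
Context {R : realType} {n T : nat} {K : finType}.
Variables (p : 'I_n * 'I_n -> R) (mu : 'I_n * 'I_n -> K -> R).
Hypothesis p01 : forall ij, ordered_pair ij -> 0 <= p ij <= 1.
Hypothesis mu_ge0 : forall ij k, ordered_pair ij -> 0 <= mu ij k.
Hypothesis mu_sum1 : forall ij, ordered_pair ij -> \sum_k mu ij k = 1.

Definition record_sum (eta : 'I_n * 'I_n -> K -> R)
    (x : {ffun 'I_n * 'I_n -> record K T}) : R :=
  \sum_(ij | ordered_pair ij) \sum_t eta ij (tagged (x ij) t).

Lemma cut_chernoff (S : {set 'I_n}) (F1 F2 : K -> R) (b s : R) :
  (forall ij, ordered_pair ij -> p ij * (\sum_k mu ij k * expR (F1 k) - 1) <= s) ->
  (forall ij, ordered_pair ij -> p ij * (\sum_k mu ij k * expR (F2 k) - 1) <= s) ->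
  \sum_(x in configs (T := T) ordered_pair | b <= record_sum (fun ij k => across S ij (F1 k) (F2 k) 0) x)
    weight ordered_pair p mu x
  <= expR (- b + T%:R * (s * (#|S|%:R * #|~: S|%:R))).
Proof.
move=> H1 H2; apply: le_trans (chernoff T p01 mu_ge0 (fun ij k => across S ij (F1 k) (F2 k) 0) b) _.
rewrite ler_expR lerD2l ler_wpM2l// -sum_across1 mulr_sumr; apply: ler_sum => ij oij.
rewrite /across; case: ifP => _; first by rewrite mulr1; exact: H1.
case: ifP => _; first by rewrite mulr1; exact: H2.
by under eq_bigr do rewrite expR0 mulr1; rewrite mu_sum1// subrr !mulr0.
Qed.

End CutChernoff.

Section UnionBound.
Context {R : realType}.

Lemma sum_exprn_card n (r : R) : \sum_(S : {set 'I_n}) r ^+ #|S| = (1 + r) ^+ n.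
Proof.
have := bigA_distr (R := R) 1 (I := 'I_n) +%R (fun _ => r) (fun _ => 1).
rewrite prodr_const card_ord addrC => ->; apply: eq_bigr => S _.
by rewrite -big_mkcond/= prodr_const.
Qed.

(** The power at the minimum is at most [r ^+ #|S| + r ^+ #|~: S|]. Each of the two sums is at most
    [(1 + r) ^+ n - 1 <= expR (n%:R * r) - 1], hence at most [2 * (n%:R * r)]. *)
Lemma sum_proper_le n (B : {set 'I_n} -> R) (r : R) : 0 <= r -> n%:R * r <= 3^-1 ->
  (forall S, S != finset.set0 -> ~: S != finset.set0 -> B S <= r ^+ minn #|S| #|~: S|) ->
  \sum_(S : {set 'I_n} | (S != finset.set0) && (~: S != finset.set0)) B S <= 4 * (n%:R * r).
Proof.
move=> r0 nr HB.
have tot : \sum_(S : {set 'I_n} | S != finset.set0) r ^+ #|S| <= 2 * (n%:R * r).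
  have := sum_exprn_card n r; rewrite (bigD1 finset.set0)//= cards0 expr0 => /eqP.
  rewrite addrC eq_sym -subr_eq => /eqP <-.
  have h : (1 + r) ^+ n <= expR (n%:R * r).
    by rewrite expRM_natl lerXn2r ?nnegrE ?expR_ge0 ?addr_ge0// expR_ge1Dx.
  have nr0 : 0 <= n%:R * r by rewrite mulr_ge0.
  have := expR_le_quadratic (_ : `|n%:R * r| <= 3^-1); rewrite ger0_norm// => /(_ nr).
  by move: h nr nr0; nra.
have -> : 4 * (n%:R * r) = 2 * (n%:R * r) + 2 * (n%:R * r) by ring.
apply: (@le_trans _ _ (\sum_(S : {set 'I_n} | (S != finset.set0) && (~: S != finset.set0))
    (r ^+ #|S| + r ^+ #|~: S|))).
  apply: ler_sum => S /andP[S0 S1]; apply: le_trans (HB _ S0 S1) _.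
  by rewrite /minn; case: ifP => _; rewrite ?lerDl ?lerDr exprn_ge0.
rewrite big_split/=; apply: lerD; apply: le_trans tot.
  rewrite big_mkcondr/=; apply: ler_sum => S _.
  by case: ifP => // _; exact: exprn_ge0.
rewrite [leRHS](reindex_inj (h := @finset.setC 'I_n)); last exact: (can_inj (@finset.setCK _)).
rewrite [leLHS]big_mkcond [leRHS]big_mkcond/=; apply: ler_sum => S _.
by do 2!case: (_ != _) => //=; exact: exprn_ge0.
Qed.

End UnionBound.

Lemma sum_exists_le (R : realType) (X I : finType) (C : {pred X}) (Q : I -> pred X) (PI : pred I)
    (W : X -> R) : (forall x, 0 <= W x) ->
  \sum_(x in C | [exists i, PI i && Q i x]) W x <= \sum_(i | PI i) \sum_(x in C | Q i x) W x.
Proof.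
move=> W0; rewrite big_mkcondr/=.
under [leRHS]eq_bigr do rewrite big_mkcondr/=.
rewrite exchange_big/=; apply: ler_sum => x _.
case: ifPn => [/existsP[i /andP[Pi Qi]]|_]; last by apply: sumr_ge0 => i _; case: ifP.
by rewrite (bigD1 i)//= Qi lerDl sumr_ge0// => j _; case: ifP.
Qed.

Section GoodConfigurations.
Context {R : realType} {n T : nat} {K : finType}.
Variables (p : 'I_n * 'I_n -> R) (mu : 'I_n * 'I_n -> K -> R) (F1 F2 : K -> R).
Variables (pmin pmax tau : R).
Hypothesis mu_ge0 : forall ij k, ordered_pair ij -> 0 <= mu ij k.
Hypothesis mu_sum1 : forall ij, ordered_pair ij -> \sum_k mu ij k = 1.
Hypothesis p_bound : forall ij, ordered_pair ij -> pmin <= p ij <= pmax.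
Hypothesis p_le1 : forall ij, ordered_pair ij -> p ij <= 1.
Hypothesis pmin_gt0 : 0 < pmin.
Hypothesis pmin_le_pmax : pmin <= pmax.
Hypothesis F1_mgf : forall ij, ordered_pair ij ->
  \sum_k mu ij k * expR (F1 k) <= 1 - tau ^+ 2 / 16.
Hypothesis F2_mgf : forall ij, ordered_pair ij ->
  \sum_k mu ij k * expR (F2 k) <= 1 - tau ^+ 2 / 16.
Hypothesis T_gt0 : (0 < T)%N.
Hypothesis n_ge4 : (4 <= n)%N.
Hypothesis tau_le1 : tau ^+ 2 <= 1.
(* With 160, a cut whose smaller side has [m] points is bad with probability at most
   [n ^ (- 5 m)], which beats the number of such cuts. *)
Hypothesis tauE : n%:R * pmin * tau ^+ 2 = 160 * ln n%:R.

Let proper (S : {set 'I_n}) := (S != finset.set0) && (~: S != finset.set0).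
Let size_cut (S : {set 'I_n}) : R := #|S|%:R * #|~: S|%:R.
Implicit Types (S : {set 'I_n}) (x : {ffun 'I_n * 'I_n -> record K T}).

Definition bad_score S x := 0 <= record_sum (fun ij k => across S ij (F1 k) (F2 k) 0) x.
(** Weights [- 1] turn a lower tail, too few comparisons across the cut, into an upper tail. *)
Definition bad_cut S x := - (T%:R * pmin / 4 * size_cut S) <=
  record_sum (fun ij k => across S ij (- 1) (- 1) 0) x.
Definition bad_degree (l : 'I_n) x := T%:R * (4 * n%:R * pmax) <=
  record_sum (fun ij k => across [set l] ij 1 1 0) x.

Definition good_config x :=
  [&& ~~ [exists S, proper S && bad_score S x], ~~ [exists S, proper S && bad_cut S x]
   & ~~ [exists l, true && bad_degree l x]].

Let W := weight ordered_pair (T := T) p mu.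
Let L : R := ln n%:R.
Let r := expR (- (5 * L)).

Let p01 ij : ordered_pair ij -> 0 <= p ij <= 1.
Proof.
move=> oij; rewrite p_le1// andbT.
by have /andP[h _] := p_bound oij; exact: le_trans (ltW pmin_gt0) h.
Qed.

Let L_ge0 : 0 <= L.
Proof. by rewrite ln_ge0// ler1n (leq_trans _ n_ge4). Qed.

Let T_ge1 : 1 <= T%:R :> R.
Proof. by rewrite ler1n. Qed.

Lemma min_card_cut S : n%:R * (minn #|S| #|~: S|)%:R <= 2 * size_cut S :> R.
Proof.
rewrite /size_cut -!natrM ler_nat.
have := cardsC S; rewrite card_ord; move: #|S| #|~: S| => a b <-.
by rewrite /minn; case: ltnP => ab; nia.
Qed.

Let exp_cut_le S y : 10 * L * (size_cut S / n%:R) <= y -> expR (- y) <= r ^+ minn #|S| #|~: S|.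
Proof.
move=> h; rewrite -expRM_natl ler_expR mulrN lerN2; apply: le_trans h.
have n0 : 0 < n%:R :> R by rewrite ltr0n (leq_trans _ n_ge4).
have : (minn #|S| #|~: S|)%:R <= 2 * (size_cut S / n%:R).
  by rewrite mulrA ler_pdivlMr// mulrC min_card_cut.
by move=> /(ler_wpM2l L_ge0); lra.
Qed.

Let size_cut_ge0 S : 0 <= size_cut S.
Proof. by rewrite mulr_ge0. Qed.

Let pmin_size_cut S : pmin * tau ^+ 2 / 16 * size_cut S = 10 * L * (size_cut S / n%:R).
Proof.
have n0 : n%:R != 0 :> R by rewrite pnatr_eq0 -lt0n (leq_trans _ n_ge4).
have -> : pmin * tau ^+ 2 = 160 * L / n%:R by rewrite -tauE; field.
by field.
Qed.

Lemma bad_score_weight S :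
  \sum_(x in configs ordered_pair (T := T) | bad_score S x) W x <= r ^+ minn #|S| #|~: S|.
Proof.
have H F ij : ordered_pair ij -> \sum_k mu ij k * expR (F k) <= 1 - tau ^+ 2 / 16 ->
    p ij * (\sum_k mu ij k * expR (F k) - 1) <= - (pmin * tau ^+ 2 / 16).
  move=> oij; set m := (\sum_k _) => hm; have /andP[p1 p2] := p_bound oij.
  have : 0 <= tau ^+ 2 by exact: sqr_ge0.
  move: (tau ^+ 2) hm => t hm t0.
  have : pmin * (t / 16) <= p ij * (1 - m).
    by apply: ler_pM => //; [exact: ltW|lra|lra].
  by lra.
apply: le_trans (cut_chernoff (s := - (pmin * tau ^+ 2 / 16)) p01 mu_ge0 mu_sum1 S 0 _ _) _.
- by move=> ij oij; apply: H => //; exact: F1_mgf.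
- by move=> ij oij; apply: H => //; exact: F2_mgf.
rewrite oppr0 add0r mulNr mulrN; apply: exp_cut_le.
rewrite pmin_size_cut -[leLHS]mul1r ler_wpM2r//.
by rewrite mulr_ge0 ?mulr_ge0// invr_ge0.
Qed.

(** As [expR (- 1) <= 2^-1], a crossing pair contributes at most [- pmin / 2] per possible
    comparison; the threshold gives back [pmin / 4], and the remaining [pmin / 4] exceeds
    [pmin * tau ^+ 2 / 16]. *)
Lemma bad_cut_weight S :
  \sum_(x in configs ordered_pair (T := T) | bad_cut S x) W x <= r ^+ minn #|S| #|~: S|.
Proof.
have H ij : ordered_pair ij ->
    p ij * (\sum_k mu ij k * expR (- 1) - 1) <= - (pmin / 2).
  move=> oij; rewrite -mulr_suml mu_sum1// mul1r.
  have : expR (- 1) <= 2^-1 :> R.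
    by rewrite expRN lef_pV2 ?posrE ?expR_gt0// expR1_ge2.
  move: (expR _) => m hm; have /andP[p1 p2] := p_bound oij.
  have : pmin * 2^-1 <= p ij * (1 - m) by apply: ler_pM => //; [exact: ltW|lra].
  by lra.
apply: le_trans (cut_chernoff (s := - (pmin / 2)) p01 mu_ge0 mu_sum1 S _ _ _) _ => //.
rewrite opprK (_ : _ + _ = - (T%:R * (pmin / 4 * size_cut S))); last by rewrite /size_cut; field.
apply: exp_cut_le; rewrite -pmin_size_cut.
apply: (@le_trans _ _ (pmin / 4 * size_cut S)).
  by rewrite ler_wpM2r//; move: tau_le1 pmin_gt0; move: (tau ^+ 2) => t; nra.
by rewrite ler_peMl// mulr_ge0// ltW// divr_gt0.
Qed.

(** As [expR 1 - 1 <= 3], the mean term is at most [3 * n%:R * pmax] per possible comparison,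
    against a threshold of [4 * n%:R * pmax]; what is left is at least [160 * ln n%:R]. *)
Lemma bad_degree_weight l :
  \sum_(x in configs ordered_pair (T := T) | bad_degree l x) W x <= r.
Proof.
have H ij : ordered_pair ij -> p ij * (\sum_k mu ij k * expR 1 - 1) <= 3 * pmax.
  move=> oij; rewrite -mulr_suml mu_sum1// mul1r.
  have := @expR1_le4 R; have := @expR1_ge2 R; move: (expR _) => m h2 h4.
  have /andP[p1 p2] := p_bound oij.
  have : p ij * (m - 1) <= pmax * 3.
    by apply: ler_pM => //; [move: pmin_gt0; lra|lra|lra].
  by lra.
apply: le_trans (cut_chernoff (s := 3 * pmax) p01 mu_ge0 mu_sum1 [set l] _ _ _) _ => //.
rewrite ler_expR cards1 mul1r.
have c1 : #|~: [set l]|%:R <= n%:R :> R by rewrite ler_nat (leq_trans (max_card _))// card_ord.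
have n0 : 0 <= n%:R :> R by [].
have pm0 : 0 < pmax by apply: lt_le_trans pmin_le_pmax.
have h1 : pmax * #|~: [set l]|%:R <= pmax * n%:R by rewrite ler_pM2l.
have h2 : 160 * L <= n%:R * pmax.
  rewrite -tauE; apply: (@le_trans _ _ (n%:R * pmin)); last by rewrite ler_wpM2l.
  by rewrite ler_piMr// mulr_ge0// ltW.
have h3 : n%:R * pmax <= T%:R * (n%:R * pmax) by rewrite ler_peMl// mulr_ge0// ltW.
have h4 : T%:R * (pmax * #|~: [set l]|%:R) <= T%:R * (pmax * n%:R) by rewrite ler_wpM2l.
by move: L_ge0; lra.
Qed.

(** The three kinds of failure weigh at most [4 * n * r], [4 * n * r] and [n * r] with [r = n ^- 5];
    the total [9 * n ^- 4] is at most [n ^- 2] as [4 <= n]. *)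
Lemma good_config_weight :
  1 - n%:R ^- 2 <= \sum_(x in configs ordered_pair (T := T) | good_config x) W x.
Proof.
have W0 x : 0 <= W x by exact: weight_ge0.
have := sum_weight T p mu_sum1; rewrite (bigID good_config)/= => tot.
rewrite -[X in X - _]tot lerBlDr lerD2l.
have n0 : 4 <= n%:R :> R by rewrite ler_nat.
have rE : r = n%:R ^- 5.
  by rewrite /r expRN expRM_natl /L lnK// posrE; lra.
have nr : n%:R * r = n%:R ^- 4 by rewrite rE; field; rewrite gt_eqF; lra.
have nr2 : 9 * (n%:R * r) <= n%:R ^- 2.
  rewrite nr -(@ler_pM2r _ (n%:R ^+ 4)) ?exprn_gt0//; last by lra.
  rewrite mulrVK ?unitfE ?gt_eqF ?exprn_gt0//; last by lra.
  rewrite (_ : n%:R ^- 2 * _ = n%:R ^+ 2); last by field; rewrite gt_eqF; lra.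
  by nra.
have n2 : n%:R ^- 2 <= 1 :> R.
  by rewrite invf_le1 ?exprn_gt0//; [nra|lra].
have nr3 : n%:R * r <= 3^-1 by have := le_trans nr2 n2; move: (n%:R * r) => y; lra.
apply: le_trans nr2.
have bound Q : (forall S, \sum_(x in configs ordered_pair (T := T) | Q S x) W x <=
      r ^+ minn #|S| #|~: S|) ->
    \sum_(x in configs ordered_pair (T := T) | [exists S, proper S && Q S x]) W x <= 4 * (n%:R * r).
  move=> HQ; apply: le_trans (sum_exists_le _ _ _ W0) _.
  by apply: sum_proper_le; [exact: expR_ge0|exact: nr3|move=> S _ _; exact: HQ].
have b1 := bound _ bad_score_weight.
have b2 := bound _ bad_cut_weight.
have b3 : \sum_(x in configs ordered_pair (T := T) | [exists l, true && bad_degree l x]) W x <= n%:R * r.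
  apply: le_trans (sum_exists_le _ _ _ W0) _.
  apply: le_trans (ler_sum _ (fun l _ => bad_degree_weight l)) _.
  by rewrite sumr_const card_ord mulr_natl.
apply: (@le_trans _ _ (4 * (n%:R * r) + (4 * (n%:R * r) + n%:R * r))); last by lra.
apply: le_trans (lerD b1 (lerD b2 b3)).
rewrite !big_mkcondr -!big_split/=; apply: ler_sum => x _.
rewrite /good_config; have := W0 x.
set e1 := [exists S, _ && bad_score S x]; set e2 := [exists S, _ && bad_cut S x].
set e3 := [exists l, _].
by rewrite -/(W x); case: e1; case: e2; case: e3 => /=; lra.
Qed.

End GoodConfigurations.

(** * High-probability guarantee for a fixed number of items *)

Section Nonasymptotic.
Context {R : realType} {d : measure_display} {Omega : measurableType d}.
Variable P : probability Omega R.
Context {n : nat}.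
Variables (k : outcome_kind) (A : set R) (f : R -> R -> R) (T : nat).
Variables (u : 'rV[R]_n) (p : 'I_n -> 'I_n -> R).
Variable N : 'I_n -> 'I_n -> {RV P >-> nat}.
Variable X : 'I_n -> 'I_n -> nat -> {RV P >-> R}.
Hypothesis model : sampling_model k A f T u p N X.
Hypothesis V : valid k A f.
Hypothesis slc : strictly_log_concave A f.
Hypothesis T_gt0 : (0 < T)%N.
Hypothesis n_ge4 : (4 <= n)%N.
Variables (M c c3 pmin pmax tau : R) (steps : nat).
Hypothesis u_range : forall i j, `|u 0 i - u 0 j| <= M.
Hypothesis score_bound : forall x t, A x -> `|t| <= M -> `|score f x t| <= c.
Hypothesis curvature : forall x t, A x -> `|t| <= M + 1 -> c3 <= `|score2 f x t|.
Hypothesis c3_gt0 : 0 < c3.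
Hypothesis c_gt0 : 0 < c.
Hypothesis p_bound : forall i j, i != j -> pmin <= p i j <= pmax.
Hypothesis pmin_gt0 : 0 < pmin.
Hypothesis pmin_le_pmax : pmin <= pmax.
Hypothesis tau_gt0 : 0 < tau.
Hypothesis tau_le1 : tau <= 1.
Hypothesis tauE : n%:R * pmin * tau ^+ 2 = 160 * ln n%:R.
Hypothesis delta_le1 : 2 * (c / c3) * tau <= 1.
Hypothesis steps_large : n%:R < (1 + pmin / (64 * pmax)) ^+ steps.

(** The minimizer of [2 * (lam * c) ^+ 2 - lam * (tau * c)], the moment bound minus the tolerance
    per comparison; the minimum is [- (tau ^+ 2 / 8)]. *)
Let lam := tau / (4 * c).
Let y (ij : 'I_n * 'I_n) := u 0 ij.1 - u 0 ij.2.
Let cellf ij := cell f c lam (y ij).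
Let mass ij := @cell_mass R k A f c lam (y ij).
(** The shift [tau ^+ 2 / 4 = lam * (tau * c)] is charged to each comparison, so a negative sum
    bounds the score by [tau * c] times the actual number of comparisons. *)
Let F1 (i : 'I_(cell_count c lam)) := lam * (cell_value i + mesh c lam) - tau ^+ 2 / 4.
Let F2 (i : 'I_(cell_count c lam)) := lam * - cell_value i - tau ^+ 2 / 4.

Let lam_gt0 : 0 < lam.
Proof. by rewrite divr_gt0// mulr_gt0. Qed.

Let lamc : lam * c = tau / 4.
Proof. by rewrite /lam; field; rewrite gt_eqF. Qed.

Let lamc_le : lam * c <= 4^-1.
Proof. by rewrite lamc; move: tau_le1; lra. Qed.

Let M_ge0 : 0 <= M.
Proof.
have n0 : (0 < n)%N by exact: leq_trans n_ge4.
by have := u_range (Ordinal n0) (Ordinal n0); rewrite subrr normr0.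
Qed.

Let tau2_le1 : tau ^+ 2 <= 1.
Proof. by rewrite expr_le1// ltW. Qed.

Let shift_mgf (a : 'I_(cell_count c lam) -> R) ij :
  \sum_i mass ij i * expR (a i) <= expR (2 * (lam * c) ^+ 2) ->
  \sum_i mass ij i * expR (a i - tau ^+ 2 / 4) <= 1 - tau ^+ 2 / 16.
Proof.
move=> h; under eq_bigr do rewrite expRD mulrA.
rewrite -mulr_suml; apply: (@le_trans _ _ (expR (- (tau ^+ 2 / 8)))).
  rewrite (_ : - (tau ^+ 2 / 8) = 2 * (lam * c) ^+ 2 + - (tau ^+ 2 / 4)).
    by rewrite expRD ler_wpM2r ?expR_ge0.
  by rewrite lamc; field.
apply: le_trans (expRN_le _) _; last by lra.
by have := sqr_ge0 tau; move: tau2_le1; lra.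
Qed.

Section Realization.
Variables (w : Omega) (x : {ffun 'I_n * 'I_n -> record 'I_(cell_count c lam) T}).
Hypothesis ev : config_event A N X cellf x w.
Hypothesis good : good_config F1 F2 pmin pmax x.

Let D i j z := \sum_(t < N i j w) ln (f (X i j t w) z).
Let g i j z := \sum_(t < N i j w) score f (X i j t w) z.
(* The model leaves [N i i] unconstrained. *)
Let e (i j : 'I_n) : R := if i == j then 0 else (N i j w)%:R.

Let N_sym i j : N i j w = N j i w.
Proof. by have [] := model_counts model. Qed.

Let X_anti i j t : i != j -> (t < N i j w)%N -> X i j t w = - X j i t w.
Proof.
have [anti _] := model_outcomes model; rewrite -val_eqE neq_ltn => /orP[ij|ji] tN.
  by rewrite (anti i j t w ij tN) opprK.
by apply: anti => //; rewrite N_sym.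
Qed.

Let X_in i j t : i != j -> (t < N i j w)%N -> A (X i j t w).
Proof.
have lt_in (i' j' : 'I_n) t' : (i' < j')%N -> (t' < N i' j' w)%N -> A (X i' j' t' w).
  move=> ij tN; have [NE XE] := config_eventP ev ij.
  by rewrite NE in tN; have [] := XE (Ordinal tN).
move=> ne tN; have := ne; rewrite -val_eqE neq_ltn => /orP[ij|ji]; first exact: lt_in.
have [symA _] := valid_dom V; rewrite X_anti//; apply: symA; apply: lt_in => //.
by rewrite N_sym.
Qed.

Let D_sym i j z : i != j -> D i j z = D j i (- z).
Proof.
move=> ij; rewrite /D (N_sym j i); apply: eq_bigr => t _.
by rewrite (valid_sym V z (X_in ij (ltn_ord t))) X_anti// opprK.
Qed.

Let g_anti i j z : i != j -> g i j z = - g j i (- z).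
Proof.
move=> ij; rewrite /g (N_sym j i) -sumrN; apply: eq_bigr => t _.
by rewrite (score_sym V slc z (X_in ij (ltn_ord t))) X_anti// opprK.
Qed.

Let D_cont i j : i != j -> continuous (D i j).
Proof.
move=> ij z; apply: cvg_big => [|t _]; first exact: add_continuous.
exact: (lnf_continuous slc (X_in ij (ltn_ord t))).
Qed.

Let D_tangent i j z z' : i != j -> D i j z' <= D i j z + g i j z * (z' - z).
Proof.
move=> ij; rewrite /g mulr_suml -big_split/=; apply: ler_sum => t _.
exact: (lnf_tangent slc _ _ (X_in ij (ltn_ord t))).
Qed.

Let D_strict i j z z' : i != j -> 0 < e i j -> z != z' ->
  D i j z' < D i j z + g i j z * (z' - z).
Proof.
move=> ij; rewrite /e (negbTE ij) ltr0n => N0 zz.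
rewrite /g mulr_suml -big_split/=; apply: ltr_sum => [|t _].
  by apply/hasP; exists (Ordinal N0); rewrite ?mem_index_enum.
exact: (lnf_tangent_lt slc (X_in ij (ltn_ord t))).
Qed.

Let g_decay i j z : i != j -> 0 <= z ->
  g i j (u 0 i - u 0 j + z) <= g i j (u 0 i - u 0 j) - c3 * e i j * Num.min z 1.
Proof.
move=> ij z0; rewrite /e (negbTE ij).
have -> : c3 * (N i j w)%:R * Num.min z 1 = \sum_(t < N i j w) c3 * Num.min z 1.
  by rewrite sumr_const card_ord -[RHS]mulr_natl; ring.
rewrite /g -sumrB; apply: ler_sum => t _.
have Ax := X_in ij (ltn_ord t).
by apply: (score_decay slc Ax M_ge0) => // s; exact: curvature.
Qed.

Let e_ge0 i j : 0 <= e i j. Proof. by rewrite /e; case: eqP. Qed.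

Let e_sym i j : e i j = e j i. Proof. by rewrite /e eq_sym N_sym. Qed.

Let record_sum_const (S : {set 'I_n}) a :
  record_sum (fun ij _ => across S ij a a 0) x = a * cut e S (~: S).
Proof.
rewrite cut_across mulr_sumr; apply: eq_bigr => -[i j]; rewrite /ordered_pair/= => ij.
have [NE _] := config_eventP ev ij.
have ne : i != j by rewrite -val_eqE neq_ltn ij.
rewrite (e_sym j i) sumr_const card_ord /e (negbTE ne) NE.
by rewrite /across; case: ifP => _; [|case: ifP => _]; rewrite ?mulr_natr ?mulr0 ?mul0rn.
Qed.

Let cut_improper (F : 'I_n -> 'I_n -> R) (S : {set 'I_n}) :
  ~~ ((S != finset.set0) && (~: S != finset.set0)) -> cut F S (~: S) = 0.
Proof.
rewrite negb_and !negbK => /orP[/eqP ->|/eqP ->]; first by rewrite /cut big_set0.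
by rewrite /cut big1// => i _; rewrite big_set0.
Qed.

(** Multiplied by [lam], the excess over [tau * c] per comparison is dominated term by term by the
    sum in [bad_score], which is negative for a good configuration. *)
Let score_le (S : {set 'I_n}) :
  cut (fun i j => g i j (u 0 i - u 0 j)) S (~: S) <= tau * c * cut e S (~: S).
Proof.
have [pS|nS] := boolP ((S != finset.set0) && (~: S != finset.set0)); last first.
  by rewrite !cut_improper// mulr0.
have /and3P[/existsPn/(_ S) + _ _] := good.
rewrite pS /= /bad_score -ltNge => neg.
rewrite -subr_le0 -(pmulr_rle0 _ lam_gt0); apply: le_trans (ltW neg).
have lt4 : lam * (tau * c) = tau ^+ 2 / 4 by rewrite mulrCA lamc; ring.
rewrite !cut_across mulr_sumr -sumrB mulr_sumr; apply: ler_sum => -[i j].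
rewrite /ordered_pair/= => ij; have [NE XE] := config_eventP ev ij.
have ne : i != j by rewrite -val_eqE neq_ltn ij.
have yM := u_range i j.
have eE : e i j = \sum_(t < tag (x (i, j))) 1.
  by rewrite /e (negbTE ne) sumr_const card_ord NE.
have gE : g i j (u 0 i - u 0 j) = \sum_(t < tag (x (i, j))) score f (X i j t w) (u 0 i - u 0 j).
  by rewrite /g NE.
rewrite (e_sym j i) (@g_anti j i); last by rewrite eq_sym.
rewrite opprB eE gE /across/=; case: ifP => _; [|case: ifP => _].
- rewrite mulr_sumr -sumrB mulr_sumr; apply: ler_sum => t _.
  have [Ax <-] := XE t; rewrite mulr1 mulrBr lt4 lerD2r ler_pM2l//.
  by have /andP[] := cell_valueP score_bound c_gt0 lam_gt0 Ax yM.
- rewrite mulr_sumr -sumrN -sumrB mulr_sumr; apply: ler_sum => t _.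
  have [Ax <-] := XE t; rewrite mulr1 mulrBr lt4 lerD2r ler_pM2l// lerN2.
  by have /andP[] := cell_valueP score_bound c_gt0 lam_gt0 Ax yM.
- by rewrite mulr0 subr0 mulr0 sumr_ge0.
Qed.

Let expansion (S : {set 'I_n}) :
  T%:R * pmin / 4 * #|S|%:R * #|~: S|%:R <= cut e S (~: S).
Proof.
have [pS|nS] := boolP ((S != finset.set0) && (~: S != finset.set0)); last first.
  rewrite cut_improper//; move: nS; rewrite negb_and !negbK => /orP[/eqP ->|/eqP ->].
    by rewrite cards0 mulr0 mul0r.
  by rewrite cards0 mulr0.
have /and3P[_ /existsPn/(_ S) + _] := good.
rewrite pS /= /bad_cut -ltNge record_sum_const; lra.
Qed.

Let degree_le (l : 'I_n) : \sum_i e i l <= T%:R * (4 * n%:R * pmax).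
Proof.
have /and3P[_ _ /existsPn/(_ l)] := good.
rewrite /= /bad_degree -ltNge record_sum_const mul1r => /ltW; apply: le_trans.
rewrite /cut big_set1 (bigD1 l)//= {1}/e eqxx add0r.
rewrite le_eqVlt; apply/orP; left; apply/eqP; by apply: eq_big => i; rewrite ?inE.
Qed.

Lemma realized_mle : exists uhat : 'rV[R]_n,
  unique (is_mle f N X w) uhat /\ `|uhat - u| <= 2 * ((2 * (c / c3) * tau) *+ steps).
Proof.
have n0 : (0 < n)%N by exact: leq_trans n_ge4.
have pmax_gt0 : 0 < pmax by exact: lt_le_trans pmin_le_pmax.
have T0 : 0 < T%:R :> R by rewrite ltr0n.
have nR0 : 0 < n%:R :> R by rewrite ltr0n.
have delta01 : 0 < 2 * (c / c3) * tau <= 1 by rewrite delta_le1 andbT !mulr_gt0// invr_gt0.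
have c3_delta : c3 * (2 * (c / c3) * tau) = 2 * (tau * c) by field; rewrite gt_eqF.
have alpha_gt0 : 0 < T%:R * pmin / 4 by rewrite divr_gt0// mulr_gt0.
have beta_gt0 : 0 < T%:R * (4 * n%:R * pmax) by rewrite !mulr_gt0.
(* Equality holds: this is the largest growth rate that the expansion and degree bounds allow. *)
have rho_le : pmin / (64 * pmax) * (T%:R * (4 * n%:R * pmax)) <= T%:R * pmin / 4 * n%:R / 4.
  by rewrite le_eqVlt; apply/orP; left; apply/eqP; field; rewrite gt_eqF.
have rho_ge0 : 0 <= pmin / (64 * pmax) by rewrite ltW// divr_gt0// mulr_gt0.
have [uhat [[[uhn uhmax] uniq] close]] := @unique_maximizer R n D g e u c3 (tau * c)
  (2 * (c / c3) * tau) (T%:R * pmin / 4) (T%:R * (4 * n%:R * pmax)) (pmin / (64 * pmax))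
  steps (Ordinal n0) erefl (model_normalized model) D_sym g_anti D_cont D_tangent D_strict g_decay
  e_ge0 e_sym c3_gt0 delta01 c3_delta score_le expansion degree_le alpha_gt0 beta_gt0
  rho_le rho_ge0 steps_large.
have llE v v' : (log_likelihood f N X w v' <= log_likelihood f N X w v) =
    (objective D (v' 0) <= objective D (v 0)).
  by rewrite /log_likelihood ler_pM2l ?invr_gt0.
exists uhat; split => //; split.
  by split => // v' /uhmax; rewrite llE.
by move=> v [vn vmax]; apply: uniq; split => // v' /vmax; rewrite llE.
Qed.

End Realization.

Lemma mle_with_high_probability : exists E : set Omega,
  [/\ measurable E, (P E >= (1 - n%:R ^- 2)%:E)%E &
      forall w, E w -> exists uhat : 'rV[R]_n,
        unique (is_mle f N X w) uhat /\ `|uhat - u| <= 2 * ((2 * (c / c3) * tau) *+ steps)].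
Proof.
have yM ij : `|y ij| <= M by exact: u_range.
have mcell ij i := measurable_cell V slc score_bound c_gt0 lam_gt0 i (yM ij).
have icell ij i := integral_cellE V slc score_bound c_gt0 lam_gt0 i (yM ij).
have [E [mE PE HE]] := good_event model mcell icell (good_config F1 F2 pmin pmax (T := T)).
exists E; split => //; last first.
  by move=> w /HE[x gx ex]; exact: realized_mle ex gx.
rewrite PE lee_fin; apply: (@good_config_weight R n T _ _ mass F1 F2 pmin pmax tau) => //.
- by move=> ij i _; exact: (cell_mass_ge0 V).
- by move=> ij _; exact: (sum_cell_mass V slc score_bound c_gt0 lam_gt0 (yM ij)).
- by move=> [i j] oij; apply: p_bound; rewrite -val_eqE neq_ltn; apply/orP; left.
- move=> [i j] oij; have ne : i != j by rewrite -val_eqE neq_ltn; apply/orP; left.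
  by have [_ /andP[]] := model_rates model ne.
- by move=> ij _; apply/shift_mgf/(cell_mgf_pos V slc score_bound c_gt0 lam_gt0 lamc_le (yM ij)).
- by move=> ij _; apply/shift_mgf/(cell_mgf_neg V slc score_bound c_gt0 lam_gt0 lamc_le (yM ij)).
Qed.

End Nonasymptotic.

(** * Error bound for the estimator *)

Section Constants.
Context {R : realType}.

Lemma omega_lty (A : set R) (f : R -> R -> R) (M : R) :
  A !=set0 -> 0 <= M -> (omega A f M < +oo)%E ->
  exists c c3 : R, [/\ omega A f M = (c / c3)%:E, 0 < c3,
    forall x t, A x -> `|t| <= M -> `|score f x t| <= c &
    forall x t, A x -> `|t| <= M + 1 -> c3 <= `|score2 f x t|].
Proof.
move=> [x0 Ax0] M0; rewrite /omega; case: ifPn => //; rewrite negb_or => /andP[c2oo c30] _.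
have c2ub x t : A x -> `|t| <= M -> ((`|score f x t|)%:E <= C2 A f M)%E.
  by move=> Ax tM; apply: ereal_sup_ubound; exists x => //; exists t.
have c3lb x t : A x -> `|t| <= M + 1 -> (C3 A f M <= (`|score2 f x t|)%:E)%E.
  by move=> Ax tM; apply: ereal_inf_lbound; exists x => //; exists t.
have C2ge0 : (0 <= C2 A f M)%E.
  by apply: le_trans (c2ub x0 0 Ax0 _); rewrite ?lee_fin ?normr0.
have C3ge0 : (0 <= C3 A f M)%E.
  by apply: le_ereal_inf_tmp => _ [x Ax [t _ <-]]; rewrite lee_fin.
have C3fin : C3 A f M \is a fin_num.
  rewrite ge0_fin_numE//; apply: le_lt_trans (c3lb x0 0 Ax0 _) (ltry _).
  by rewrite normr0 addr_ge0.
have C2fin : C2 A f M \is a fin_num by rewrite ge0_fin_numE// lt_neqAle c2oo leey.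
exists (fine (C2 A f M)), (fine (C3 A f M)).
have c3gt0 : 0 < fine (C3 A f M).
  by rewrite fine_gt0// lt_neqAle eq_sym c30 C3ge0 -ge0_fin_numE.
split => //.
- by rewrite -{1}(fineK C2fin) -{1}(fineK C3fin) inver gt_eqF.
- by move=> x t Ax tM; rewrite -lee_fin fineK//; exact: c2ub.
- by move=> x t Ax tM; rewrite -lee_fin fineK//; exact: c3lb.
Qed.

(** Since [expR (rho / 2) <= 1 + rho], any number of steps above [2 / rho * ln n%:R] suffices;
    rounding up costs the final 1. *)
Lemma exp_growth_steps (n : nat) (rho : R) : (0 < n)%N -> 0 < rho <= 3^-1 ->
  exists2 s : nat, n%:R < (1 + rho) ^+ s & s%:R <= 2 / rho * ln n%:R + 1.
Proof.
move=> n0 /andP[r0 r1]; have nR : 1 <= n%:R :> R by rewrite ler1n.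
have q0 : 0 <= 2 / rho * ln n%:R by rewrite !mulr_ge0 ?ln_ge0// invr_ge0 ltW.
exists (Num.trunc (2 / rho * ln n%:R)).+1; last first.
  by rewrite -natr1 lerD2r truncn_le.
have e1 : expR (rho / 2) <= 1 + rho.
  apply: le_trans (expR_le_quadratic _) _; first by rewrite ger0_norm; lra.
  by nra.
apply: (@lt_le_trans _ _ (expR (rho / 2) ^+ (Num.trunc (2 / rho * ln n%:R)).+1)); last first.
  by rewrite lerXn2r ?nnegrE ?expR_ge0//; lra.
rewrite -expRM_natl -[ltLHS]lnK ?posrE ?(lt_le_trans ltr01 nR)// ltr_expR.
have /andP[_ h] := truncn_itv q0.
rewrite [ltLHS](_ : _ = 2 / rho * ln n%:R * (rho / 2)); last by field; rewrite gt_eqF.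
by rewrite ltr_pM2r ?divr_gt0.
Qed.

End Constants.

Section RateBounds.
Context {R : realType} {n : nat}.
Variable p : 'I_n -> 'I_n -> R.

Lemma dynamic_range_ge (u : 'rV[R]_n) i j : `|u 0 i - u 0 j| <= dynamic_range u.
Proof. exact: (le_bigmax _ (fun ij : 'I_n * 'I_n => `|u 0 ij.1 - u 0 ij.2|) (i, j)). Qed.

Lemma rate_bounds i j : i != j -> min_rate p <= p i j <= max_rate p.
Proof.
move=> ij; apply/andP; split.
  exact: (bigmin_le_cond _ (fun ij : 'I_n * 'I_n => p ij.1 ij.2) (j := (i, j)) ij).
exact: (le_bigmax_cond _ (fun ij : 'I_n * 'I_n => p ij.1 ij.2) (j := (i, j)) ij).
Qed.

Lemma min_rate_gt0 : rates p -> 0 < min_rate p.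
Proof.
move=> rt; rewrite /min_rate; elim/big_ind : _ => // [a b a0 b0|[i j] /= ij].
  by rewrite lt_min a0.
by have [_ /andP[]] := rt i j ij.
Qed.

End RateBounds.

Section FiniteSample.
Context {R : realType} {d : measure_display} {Omega : measurableType d}.
Variable P : probability Omega R.
Context {n : nat}.
Variables (k : outcome_kind) (A : set R) (f : R -> R -> R) (T : nat).
Variables (u : 'rV[R]_n) (p : 'I_n -> 'I_n -> R).
Variable N : 'I_n -> 'I_n -> {RV P >-> nat}.
Variable X : 'I_n -> 'I_n -> nat -> {RV P >-> R}.

Lemma mle_error_bound : valid k A f -> strictly_log_concave A f -> (0 < T)%N ->
  sampling_model k A f T u p N X -> (4 <= n)%N -> (Delta A f u p < (40^-1)%:E)%E ->
  exists E : set Omega,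
    [/\ measurable E, (P E >= (1 - n%:R ^- 2)%:E)%E &
        forall w, E w -> exists uhat : 'rV[R]_n,
          unique (is_mle f N X w) uhat /\
          (* [6708 = 4 * 13 * 129], with [13 >= sqrt 160] and at most [129 * (pM / pm * ln n)] steps *)
          ((`|uhat - u|)%:E <= 6708%:E * Delta A f u p)%E].
Proof.
move=> V slc T0 model n4 small.
have n0 : (0 < n)%N by exact: leq_trans n4.
have n1 : (1 < n)%N by exact: leq_trans n4.
have nR : 4 <= n%:R :> R by rewrite ler_nat.
set L := ln n%:R : R.
have L1 : 1 <= L.
  by rewrite -[leLHS]expRK ler_ln ?posrE ?expR_gt0 ?(le_trans expR1_le4 nR)//; lra.
have M0 : 0 <= dynamic_range u.
  by apply: le_trans (dynamic_range_ge u (Ordinal n0) (Ordinal n0)).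
have rt := model_rates model.
have pm0 := min_rate_gt0 rt.
have pmM : min_rate p <= max_rate p.
  have /andP[h1 h2] := rate_bounds p (isT : Ordinal n0 != Ordinal n1); exact: le_trans h1 h2.
move: pm0 pmM (@rate_bounds _ _ p) small; rewrite /Delta -/L.
set pm := min_rate p; set pM := max_rate p => pm0 pmM pb.
set s := Num.sqrt _ => small.
have pM0 : 0 < pM by exact: lt_le_trans pmM.
have nR0 : 0 < n%:R :> R by lra.
have L0 : 0 < L by lra.
pose t := Num.sqrt (L / (n%:R * pm)).
have t0 : 0 < t by rewrite sqrtr_gt0 divr_gt0// mulr_gt0.
have t2 : t ^+ 2 = L / (n%:R * pm) by rewrite sqr_sqrtr// ltW// divr_gt0// mulr_gt0.
(* The factor [pM / pm * L] pays for the number of steps, and [t] is the scale of the error in one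
   step. *)
have sE : s = pM / pm * L * t.
  have h0 : 0 <= pM / pm * L * t by rewrite !mulr_ge0// ?invr_ge0// ltW.
  rewrite -[RHS](ger0_norm h0) -sqrtr_sqr /s; congr Num.sqrt.
  by rewrite !exprMn t2; field; rewrite !gt_eqF.
have s0 : 0 < s by rewrite sE !mulr_gt0// invr_gt0.
have [x0 Ax0 _] := exists_neg V slc.
(* As [s] is positive, an infinite [omega] would make [Delta] infinite. *)
have omega_fin : (omega A f (dynamic_range u) < +oo)%E.
  rewrite ltey; apply/negP => /eqP om; move: small.
  by rewrite om gt0_mulye ?lte_fin// ltNge leey.
have [c [c3 [omE c30 score_bound curv]]] := omega_lty (ex_intro _ x0 Ax0) M0 omega_fin.
rewrite omE -EFinM lte_fin in small *.
(* The factors [c / c3], [pM / pm] and [L] are thus all at least 1, so smallness of [Delta] makes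
   [t] and [tau] small as well. *)
have cc3 : c3 <= c.
  exact: (score_ge_curvature V slc M0 score_bound curv (ltW c30)).
have c0 : 0 < c by exact: lt_le_trans cc3.
have om1 : 1 <= c / c3 by rewrite ler_pdivlMr// mul1r.
have ratio1 : 1 <= pM / pm by rewrite ler_pdivlMr// mul1r.
have ts : t <= s by rewrite sE ler_peMl ?(ltW t0)// mulr_ege1.
have os : s <= c / c3 * s by rewrite ler_peMl// ltW.
pose tau := Num.sqrt (160 * (L / (n%:R * pm))).
have tau0 : 0 < tau by rewrite sqrtr_gt0 mulr_gt0// divr_gt0// mulr_gt0.
have tau2 : tau ^+ 2 = 160 * (L / (n%:R * pm)).
  by rewrite sqr_sqrtr// mulr_ge0// ltW// divr_gt0// mulr_gt0.
have tau13 : tau <= 13 * t.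
  rewrite -(@ler_pXn2r _ 2) ?nnegrE ?(ltW tau0)// ?mulr_ge0 ?(ltW t0)//.
  by rewrite exprMn t2 tau2 ler_wpM2r// ?ltW ?divr_gt0 ?mulr_gt0//; lra.
have tau1 : tau <= 1 by move: small os ts tau13; lra.
have tauE : n%:R * pm * tau ^+ 2 = 160 * ln n%:R.
  by rewrite tau2 -/L; field; rewrite !gt_eqF.
have ot : c / c3 * tau <= c / c3 * (13 * t) by rewrite ler_pM2l// (lt_le_trans ltr01 om1).
have ot2 : c / c3 * t <= c / c3 * s by rewrite ler_pM2l// (lt_le_trans ltr01 om1).
(* The threshold [40^-1] enters here: [2 * 13 / 40 < 1] keeps one step of the level within the range
   where the curvature is controlled. *)
have delta1 : 2 * (c / c3) * tau <= 1 by move: small ot ot2; lra.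
have rho01 : 0 < pm / (64 * pM) <= 3^-1.
  rewrite divr_gt0 ?mulr_gt0//= ler_pdivrMr ?mulr_gt0//; lra.
have [steps growth steps_le] := exp_growth_steps n0 rho01.
have {}steps_le : steps%:R <= 129 * (pM / pm * L).
  apply: le_trans steps_le _; rewrite -/L.
  have -> : 2 / (pm / (64 * pM)) * L = 128 * (pM / pm * L) by field; rewrite !gt_eqF.
  have : 1 <= pM / pm * L by rewrite mulr_ege1.
  lra.
have [E [mE PE HE]] := mle_with_high_probability model V slc T0 n4 (@dynamic_range_ge _ _ u)
  score_bound curv c30 c0 pb pm0 pmM tau0 tau1 tauE delta1 growth.
exists E; split => // w /HE[uhat [uq close]]; exists uhat; split => //.
rewrite lee_fin; apply: le_trans close _.
have om0 : 0 < c / c3 by exact: lt_le_trans om1.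
rewrite -[_ *+ steps]mulr_natr.
apply: (@le_trans _ _ (2 * (2 * (c / c3) * (13 * t) * (129 * (pM / pm * L))))).
  rewrite ler_pM2l//; apply: ler_pM => //.
  - by rewrite mulr_ge0 ?(ltW tau0)// mulr_ge0 ?(ltW om0).
  - by rewrite ler_pM2l// mulr_gt0.
by rewrite sE le_eqVlt; apply/orP; left; apply/eqP; ring.
Qed.

End FiniteSample.

Theorem theorem2 (R : realType) :
  exists C : R, 0 < C /\
  forall (k : outcome_kind) (A : set R) (f : R -> R -> R) (T : nat)
    (d : nat -> measure_display) (Omega : forall n, measurableType (d n))
    (P : forall n, probability (Omega n) R)
    (u : forall n, 'rV[R]_n) (p : forall n, 'I_n -> 'I_n -> R)
    (N : forall n, 'I_n -> 'I_n -> {RV (P n) >-> nat})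
    (X : forall n, 'I_n -> 'I_n -> nat -> {RV (P n) >-> R}),
  bounded_set A ->
  valid k A f ->
  strictly_log_concave A f ->
  (1 <= T)%N ->
  (forall n, sampling_model k A f T (u n) (p n) (N n) (X n)) ->
  Delta A f (u n) (p n) @[n --> \oo] --> 0%E ->
  ln n%:R / (n%:R * min_rate (p n) *
             `|ln (fine (C1 k A f (dynamic_range (u n))))|)
    @[n --> \oo] --> (0 : R) ->
  \forall n \near \oo, exists E : set (Omega n),
    [/\ measurable E,
        (P n E >= (1 - n%:R ^- 2)%:E)%E &
        forall w, E w -> exists uhat : 'rV[R]_n,
          unique (is_mle f (N n) (X n) w) uhat /\
          ((`|uhat - u n|)%:E <= C%:E * Delta A f (u n) (p n))%E].
Proof.
exists 6708; split; first by rewrite ltr0n.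
move=> k A f T d Omega P u p N X _ V slc T1 model Delta0 _.
have small : \forall n \near \oo, (Delta A f (u n) (p n) < (40^-1)%:E)%E.
  apply: (Delta0 [set x | (x < (40^-1)%:E)%E]).
  by apply: open_ereal_lt'; rewrite lte_fin invr_gt0.
have large : \forall n \near \oo, (4 <= n)%N by exists 4.
apply: filterS2 large small => n n4 small.
exact: mle_error_bound V slc T1 (model n) n4 small.
Qed.
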